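(* Assume the Riemann hypothesis. Let $N:(0,\Delta)\to(0,\infty)$ be a function satisfying $$\int_2^{N(\delta)}P(t)\,{\rm d}t=-\frac{a}{\delta}+\mathcal{O}(1),\qquad \delta\in(0,\Delta),$$ where $a=e^{4.5}$ and $\mathcal{O}(1)$ denotes a continuous bounded function of $\delta$. Let $k\ge2$ be a fixed integer and let $(2\bar l_1,\dots,2\bar l_k)\in(\mathbb{R}^+)^k$ be any vector with $\prod_{r=1}^k(2\bar l_r)=a$ (there is a continuum of such vectors). Then $$\int_2^{N\left(\frac{1}{\ln^kT}\right)}\{-P(t)\}\,{\rm d}t\sim\prod_{r=1}^k\int_{[T]^1}^{[T+2\bar l_r]^1}\left|\zeta\left(\tfrac12+it\right)\right|^2{\rm d}t,\qquad T\to\infty.$$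
   Context: $\pi(t)$ is the prime-counting function and $P(t)$ is defined by $\pi(t)=\mathrm{li}(t)+P(t)$, $\mathrm{li}(t)=\int_0^t\frac{{\rm d}u}{\ln u}$ (principal value). Jacob's ladder: let $Z(t)=e^{i\vartheta(t)}\zeta(\frac12+it)$ be Hardy's function; $\varphi_1(T)=\frac12\varphi(T)$, where $\varphi(T)$ is a solution of $\int_0^{\mu[\varphi(T)]}Z^2(t)e^{-\frac{2}{\varphi(T)}t}{\rm d}t=\int_0^TZ^2(t){\rm d}t$ with an admissible $\mu(y)\ge 7y\ln y$ (Moser). For large arguments $\varphi_1$ is increasing and unbounded; $[G]^1=\varphi_1^{-1}(G)$. Known property: for every fixed $l>0$, $\int_{[T]^1}^{[T+2l]^1}|\zeta(\frac12+it)|^2{\rm d}t=\{1+\mathcal{O}(\frac{\ln\ln T}{\ln T})\}2l\ln T$ as $T\to\infty$. *)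

(* Defs.v *)
(* MathComp-Analysis; complex numbers are [R[i]] over an arbitrary [R : realType]. *)
From HB Require Import structures.
From mathcomp Require Import all_boot all_order all_algebra.
From mathcomp Require Import complex.
From mathcomp Require Import all_classical all_reals all_analysis.

Set Implicit Arguments.
Unset Strict Implicit.
Unset Printing Implicit Defensive.

Import Order.TTheory GRing.Theory Num.Theory.
Import numFieldNormedType.Exports.

Local Open Scope classical_set_scope.
Local Open Scope ring_scope.

Section Defs.
Context {R : realType}.
Implicit Types (a b t x y : R) (f : R -> R).

(* Lebesgue integral from a to b, with the sign convention for b < a. *)
Definition oint a b f : R :=
  if a <= b then \int[lebesgue_measure]_(x in `[a, b]) f x
  else - \int[lebesgue_measure]_(x in `[b, a]) f x.

Definition primepi t : nat := (\sum_(0 <= p < (Num.truncn t).+1 | prime p) 1)%N.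

(* Principal value: a symmetric neighbourhood of the pole u = 1 is removed.
   For 0 <= t < 1 nothing is removed once e is small. *)
Definition li t : R :=
  lim ((fun e : R => \int[lebesgue_measure]_(u in `[0, t] `&` [set u | e < `|u - 1|])
                       (ln u)^-1) @ 0^'+).

Definition prime_error t : R := (primepi t)%:R - li t.

(* x^s = exp (s ln x), for 0 < x. *)
Definition cpow x (s : R[i]) : R[i] :=
  Complex (x `^ complex.Re s * cos (complex.Im s * ln x))
          (x `^ complex.Re s * sin (complex.Im s * ln x)).

(* Riemann zeta function on the half-plane Re s > 0, s <> 1: the limit of
     sum_(1 <= m <= n) m^-s - n^(1-s) / (1-s).
   For Re s > 1 the correction term tends to 0 and this is the Dirichlet series;
   by Euler-Maclaurin summation the limit is locally uniform on Re s > 0, s <> 1,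
   so that it is the analytic continuation there. No value outside of this domain
   is used. *)
Definition zeta (s : R[i]) : R[i] :=
  lim ((fun n : nat => (\sum_(1 <= m < n.+1) cpow m%:R (- s)
                       - cpow n%:R (1 - s) / (1 - s) : R[i]^o)) @ \oo).

Definition critical_line t : R[i] := Complex 2^-1 t.

Definition riemann_hypothesis : Prop :=
  forall s : R[i], 0 < complex.Re s < 1 -> zeta s = 0 -> complex.Re s = 2^-1.

(* theta(t) = arg Gamma(1/4 + i t/2) - (t/2) ln pi, with the continuous branch of
   the argument vanishing at t = 0. By Gauss's product
   Gamma(z) = lim n! n^z / (z (z+1) ... (z+n)) this branch is
   lim ((Im z) ln n - sum_(0 <= j <= n) arg (z + j)). *)
Definition theta t : R :=
  lim ((fun n : nat => t / 2 * ln n%:R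
          - \sum_(0 <= j < n.+1) atan (t / 2 / (4^-1 + j%:R))) @ \oo)
  - t / 2 * ln pi.

(* Z(t) = exp (i theta(t)) zeta(1/2 + i t), as a complex number. *)
Definition hardyZ t : R[i] :=
  Complex (cos (theta t)) (sin (theta t)) * zeta (critical_line t).

(* Z(t) is real by the functional equation, so Z^2(t) is its squared modulus. *)
Definition hardyZ2 t : R := Normc.normc (hardyZ t) ^+ 2.

Definition zeta_sq t : R := Normc.normc (zeta (critical_line t)) ^+ 2.

Definition admissible (mu : R -> R) : Prop :=
  \forall y \near +oo, 7 * y * ln y <= mu y.

Definition phi1 (phi : R -> R) (T : R) : R := phi T / 2.

(* phi is a Jacob's ladder generated by mu on the half-line [T0, +oo[. The last
   two clauses say that phi1 is increasing and unbounded there and has an inverse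
   defined on [phi1 T0, +oo[. *)
Definition jacobs_ladder (mu phi : R -> R) (T0 : R) : Prop :=
  [/\ admissible mu,
      forall T, T0 <= T ->
        oint 0 (mu (phi T)) (fun t => hardyZ2 t * expR (- (2 / phi T * t)))
        = oint 0 T hardyZ2,
      {in `[T0, +oo[ &, {homo phi1 phi : x y / x < y}} &
      phi1 phi @` `[T0, +oo[ = [set` `[phi1 phi T0, +oo[] ].

(* [G]^1, the preimage of G under phi1 on [T0, +oo[; meaningful for large G. *)
Definition ladder_inv (phi : R -> R) (T0 G : R) : R :=
  'pinv_(fun=> T0) `[T0, +oo[ (phi1 phi) G.

End Defs.

(* Main.v *)
(* The moment identity defining a Jacob's ladder turns the integral of |zeta|^2
   over [[T]^1, [T + 2 l]^1] into an increment of the Laplace transform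
     I(D) = int_0^oo |zeta(1/2 + i t)|^2 exp (- D t) dt
   between D = 1 / T and D = 1 / (T + 2 l), up to O(1); I is convex, so
   I(D) ~ ln (1 / D) / D (D -> 0+) already forces this increment to be ~ 2 l ln T.
   The asymptotics of I is obtained by comparing zeta with its Dirichlet
   polynomial S of length x ~ 1 / D.  The transform of cos (lam t) is the Poisson
   kernel kern D lam = D / (D^2 + lam^2), so mean squares of trigonometric sums
   are quadratic forms in kern D: the diagonal for S gives ln x / D, and the rest
   is O(1 / D).  For the error E = zeta - S, the factor 1 - 2^(1 - s) is bounded
   below on the critical line, and (1 - 2^(1 - s)) E is a tail of the alternating
   series sum (-1)^(n-1) n^-s, plus a block x < n <= 2 x, plus a remainder bounded
   pointwise; Schur's test for kern D and its second differences gives O(1 / D). *)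
Require Import Defs.
From HB Require Import structures.
From mathcomp Require Import all_boot all_order all_algebra.
From mathcomp Require Import complex.
From mathcomp Require Import all_classical all_reals all_analysis.
From mathcomp Require Import measurable_realfun.
From mathcomp Require Import ring lra zify.

Set Implicit Arguments.
Unset Strict Implicit.
Unset Printing Implicit Defensive.

Import Order.TTheory GRing.Theory Num.Theory.
Import numFieldNormedType.Exports.

Local Open Scope classical_set_scope.
Local Open Scope ring_scope.

(** * Laplace transforms *)

Section LaplaceIntegral.
Context {R : realType}.
Implicit Types (D lam t : R) (f g : R -> R).
Notation mu := lebesgue_measure.

(** The obstacle is a mismatch of lengths. After n terms the sequence defining zeta at 1/2 + i t has
    squared error of order (1 + t^2) / n, and the weight exp (- D t) lets t run up to about 1 / D,
    so a pointwise bound needs about D^-2 terms. For a Dirichlet polynomial of length n the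
    off-diagonal bound D n^2 is O(1 / D) only up to n ~ 1 / D. The factor 1 - 2^(1 - s) bridges the
    gap: it cancels the pole terms n^(1 - s) / (1 - s), and it pairs the terms 2 j + 1 and 2 j + 2,
    whose difference is smaller by a factor of about (1 + t) / j. Conversely x >= 1 / D makes the
    logarithmic frequencies beyond x at most D apart, the width of the kernel, as the row sums in
    Schur's test require; so x ~ 1 / D is imposed from both sides. The increment of I that is wanted
    runs over a step of order D^2, far below what an asymptotic equivalence resolves. Convexity
    compares it with increments over steps e D, where the equivalence does give a main term; e tends
    to 0 only after D. *)

Definition laplace D f : R :=
  \int[@lebesgue_measure R]_(t in `[0, +oo[) (f t * expR (- (D * t))).

(** Quadratic growth is the crude bound available for |zeta|^2 on the critical line. It makes the
    transform converge for every D > 0, which linearity and monotonicity of the real-valued integral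
    rely on. *)
Definition tame f : Prop := measurable_fun (setT : set (measurableTypeR R)) f /\
  exists C, forall t, 0 <= t -> `|f t| <= C * (1 + t ^+ 2).

Lemma measurable_itvR (i : interval R) : measurable ([set` i] : set (measurableTypeR R)).
Proof. exact: measurable_itv. Qed.

Lemma expRN_cvgy D : 0 < D -> expR (- (D * t)) @[t --> +oo] --> 0.
Proof.
move=> D0.
rewrite (_ : (fun t => _) = (fun z => expR (- z)) \o (fun z => D * z)) //.
apply: (@cvg_comp _ _ _ _ _ _ (pinfty_nbhs R)); last exact: cvgr_expR.
exact: gt0_cvgMry.
Qed.

(** The summand 1 makes the integrand nonnegative, as the fundamental theorem of calculus on a
    half-line asks; [F] is the antiderivative that vanishes at infinity. The case lam = 0 then
    yields integrability of the exponential, and subtraction isolates the cosine. *)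
Lemma laplace_1cos D lam : 0 < D ->
  (\int[mu]_(t in `[(0:R)%R, +oo[) ((1 + cos (lam * t)) * expR (- (D * t)))%:E
   = (D^-1 + D / (D ^+ 2 + lam ^+ 2))%:E)%E.
Proof.
move=> D0.
have D20 : 0 < D ^+ 2 + lam ^+ 2 by rewrite ltr_wpDr ?sqr_ge0 ?exprn_gt0.
pose q := (D ^+ 2 + lam ^+ 2)^-1.
pose F t := (q * (lam * sin (lam * t) - D * cos (lam * t)) - D^-1) * expR (- (D * t)).
have dF t : is_derive t (1 : R) F ((1 + cos (lam * t)) * expR (- (D * t))).
  apply: is_derive_eq.
  rewrite /GRing.scale /=.
  have -> : q = (D ^+ 2 + lam ^+ 2)^-1 by [].
  by field; rewrite !gt_eqF.
have cF : continuous F.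
  by move=> t; apply/differentiable_continuous/derivable1_diffP; case: (dF t).
rewrite (@ge0_continuous_FTC2y _ _ F 0 0).
- rewrite /F !mulr0 sin0 cos0 oppr0 expR0 -EFinB /q; congr EFin.
  by field; rewrite !gt_eqF.
- by move=> t _; rewrite mulr_ge0 ?expR_ge0// -lerBlDl sub0r cos_geN1.
- apply: continuous_subspaceT => t.
  apply/differentiable_continuous/derivable1_diffP.
  exact: ex_derive.
- apply/norm_cvg0P.
  apply: (@squeeze_cvgr _ _ _ _ (cst 0) (fun t => (q * (`|lam| + D) + D^-1) * expR (- (D * t)))); first last.
  + by rewrite -[X in _ --> X](mulr0 (q * (`|lam| + D) + D^-1)); apply: cvgMr; exact: expRN_cvgy.
  + exact: cvg_cst.
  near=> t; rewrite normr_ge0/= /F normrM [`|expR _|]ger0_norm ?expR_ge0//.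
  rewrite ler_wpM2r ?expR_ge0//.
  apply: (le_trans (ler_normB _ _)); rewrite [`|D^-1|]gtr0_norm ?invr_gt0// lerD2r.
  have q0 : 0 <= q by rewrite invr_ge0 ltW.
  rewrite normrM (ger0_norm q0) ler_wpM2l//.
  apply: (le_trans (ler_normB _ _)); rewrite !normrM (gtr0_norm D0).
  by apply: lerD; rewrite ler_piMr ?normr_ge0 ?(ltW D0)// ler_norml ?sin_geN1 ?sin_le1 ?cos_geN1 ?cos_le1.
- by move=> t _; case: (dF t).
- by apply: cvg_at_right_filter; exact: cF.
- by move=> t _; rewrite derive1E; case: (dF t).
Unshelve. all: by end_near. Qed.

Lemma continuous_measurableW (A : set (measurableTypeR R)) f :
  continuous f -> measurable_fun A f.
Proof. by move=> cf; exact: (measurable_funTS (continuous_measurable_fun cf)). Qed.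

Lemma measurable_expRN (A : set (measurableTypeR R)) D : measurable_fun A (fun t : R => expR (- (D * t))).
Proof.
apply: continuous_measurableW => t.
by apply/differentiable_continuous/derivable1_diffP; exact: ex_derive.
Qed.

Lemma laplace_integrable_exp D : 0 < D ->
  lebesgue_measure.-integrable `[(0:R), +oo[ (EFin \o (fun t => expR (- (D * t)))).
Proof.
move=> D0; have D10 : D != 0 by rewrite gt_eqF.
apply/integrableP; split.
  by apply/measurable_EFinP; exact: measurable_expRN.
have := @laplace_1cos D 0 D0.
have -> : (\int[mu]_(t in `[(0:R)%R, +oo[) ((1 + cos (0 * t)) * expR (- (D * t)))%:E
   = \int[mu]_(t in `[(0:R)%R, +oo[) (2%:E * (expR (- (D * t)))%:E))%E.
  by apply: eq_integral => t _; rewrite mul0r cos0 -EFinM; congr (_ * _)%:E; ring.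
rewrite ge0_integralZl//=; last first.
  by apply/(measurable_EFinP _ (fun t => expR (- (D * t)))); exact: measurable_expRN.
move=> h.
under eq_integral do rewrite /= ger0_norm ?expR_ge0//.
move: h; case: (\int[mu]_(x in `[(0:R)%R, +oo[) (expR (- (D * x)))%:E)%E => [r _| |]; first by rewrite ltry.
  by rewrite gt0_muley// lte_fin.
by [].
Qed.

Lemma sqr_le_expR (z : R) : 0 <= z -> z ^+ 2 / 2 <= expR z.
Proof.
move=> z0; have := expR_ge1Dxn 1 z0.
by rewrite (_ : 2`! = 2%N)//; lra.
Qed.

(** Half of the exponent is spent on the polynomial: z^2 / 2 <= exp z at z = D t / 2 gives t^2 <= (8
    / D^2) exp (D t / 2). *)
Lemma oneDsqr_le_expR D t : 0 < D -> 0 <= t ->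
  (1 + t ^+ 2) * expR (- (D * t)) <= (1 + 8 / D ^+ 2) * expR (- (D / 2 * t)).
Proof.
move=> D0 t0.
have -> : expR (- (D * t)) = expR (- (D / 2 * t)) * expR (- (D / 2 * t)).
  by rewrite -expRD; congr expR; field.
rewrite mulrA ler_wpM2r ?expR_ge0// expRN.
have e1 : 1 <= expR (D / 2 * t) by rewrite -expR0 ler_expR mulr_ge0 ?divr_ge0// ltW.
have e0 : 0 < expR (D / 2 * t) by rewrite expR_gt0.
rewrite ler_pdivrMr// mulrDl mul1r lerD//.
have /sqr_le_expR : 0 <= D / 2 * t by rewrite mulr_ge0 ?divr_ge0// ltW.
have D2 : 0 < D ^+ 2 by rewrite exprn_gt0.
rewrite -(ler_pM2l (_ : 0 < 8 / D ^+ 2)) ?divr_gt0//.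
by apply: le_trans; rewrite le_eqVlt; apply/orP; left; apply/eqP; field; rewrite gt_eqF.
Qed.

Lemma tame_integrable D f : 0 < D -> tame f ->
  lebesgue_measure.-integrable `[(0:R), +oo[ (EFin \o (fun t => f t * expR (- (D * t)))).
Proof.
move=> D0 [mf [C fC]].
have mfe : measurable_fun (`[(0:R), +oo[%classic : set (measurableTypeR R)) (fun t => f t * expR (- (D * t))).
  apply: measurable_funM; first exact: measurable_funTS.
  exact: measurable_expRN.
have D20 : 0 < D / 2 by rewrite divr_gt0.
apply: (@le_integrable _ _ _ mu _ _ _ (fun t => (C * (1 + 8 / D ^+ 2))%:E * (EFin \o (fun t => expR (- (D / 2 * t)))) t)%E).
- exact: measurable_itv.
- exact/measurable_EFinP.
- move=> t /=; rewrite in_itv/= andbT => t0; rewrite lee_fin normrM [`|expR _|]ger0_norm ?expR_ge0//.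
  have C0 : 0 <= C.
    by have := fC 0 (lexx 0); rewrite expr0n/= addr0 mulr1; apply: le_trans.
  apply: le_trans (ler_norm _).
  apply: (@le_trans _ _ (C * ((1 + t ^+ 2) * expR (- (D * t))))).
    by rewrite mulrA ler_wpM2r ?expR_ge0// fC.
  by rewrite -(mulrA C (1 + _)) ler_wpM2l// oneDsqr_le_expR.
- exact: (integrableZl (measurable_itvR _) _ (laplace_integrable_exp D20)).
Qed.

Lemma tameD f g : tame f -> tame g -> tame (fun t => f t + g t).
Proof.
move=> [mf [C fC]] [mg [C' gC]]; split; first exact: measurable_funD.
exists (C + C') => t t0; rewrite mulrDl (le_trans (ler_normD _ _))// lerD//; [exact: fC|exact: gC].
Qed.

Lemma tameZ k f : tame f -> tame (fun t => k * f t).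
Proof.
move=> [mf [C fC]]; split; first exact: measurable_funM.
by exists (`|k| * C) => t t0; rewrite normrM -mulrA ler_wpM2l// fC.
Qed.

Lemma tame_cst k : tame (fun=> k).
Proof.
split; first exact: measurable_cst.
exists `|k| => t t0; rewrite ler_peMr// lerDl sqr_ge0 //.
Qed.

Lemma tame_sum (I : Type) (r : seq I) (P : pred I) (F : I -> R -> R) :
  (forall i, tame (F i)) -> tame (fun t => \sum_(i <- r | P i) F i t).
Proof.
move=> tF; elim: r => [|i r IH].
  by under eq_fun do rewrite big_nil; exact: tame_cst.
under eq_fun do rewrite big_cons.
by case: (P i) => //; apply: tameD.
Qed.

Lemma tame_cos lam : tame (fun t => cos (lam * t)).
Proof.
split.
  apply: continuous_measurableW => t.
  by apply/differentiable_continuous/derivable1_diffP; exact: ex_derive.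
exists 1 => t t0; rewrite mul1r (@le_trans _ _ 1)//; last by rewrite lerDl sqr_ge0.
by rewrite ler_norml cos_geN1 cos_le1.
Qed.

Lemma tame_le f g : measurable_fun (setT : set (measurableTypeR R)) f -> tame g ->
  (forall t, 0 <= t -> `|f t| <= g t) -> tame f.
Proof.
move=> mf [_ [C gC]] fg; split=> //; exists C => t t0.
by rewrite (le_trans (fg _ t0))// (le_trans (ler_norm _)) ?gC.
Qed.

Lemma laplaceD D f g : 0 < D -> tame f -> tame g ->
  laplace D (fun t => f t + g t) = laplace D f + laplace D g.
Proof.
move=> D0 tf tg; rewrite /laplace -RintegralD//=; try exact: tame_integrable.
by apply: eq_Rintegral => t _; rewrite mulrDl.
Qed.

Lemma laplaceZ D k f : 0 < D -> tame f ->
  laplace D (fun t => k * f t) = k * laplace D f.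
Proof.
move=> D0 tf; rewrite /laplace -RintegralZl//=; try exact: tame_integrable.
by apply: eq_Rintegral => t _; rewrite mulrA.
Qed.

Lemma le_laplace D f g : 0 < D -> tame f -> tame g ->
  (forall t, 0 <= t -> f t <= g t) -> laplace D f <= laplace D g.
Proof.
move=> D0 tf tg fg; apply: le_Rintegral; [exact: measurable_itv|exact: tame_integrable..|].
by move=> t; rewrite /= in_itv/= andbT => t0; rewrite ler_wpM2r ?expR_ge0// fg.
Qed.

Lemma laplace_ge0 D f : (forall t, 0 <= t -> 0 <= f t) -> 0 <= laplace D f.
Proof.
move=> f0; apply: Rintegral_ge0 => t; rewrite /= in_itv/= andbT => t0.
by rewrite mulr_ge0 ?f0// expR_ge0.
Qed.

Lemma laplace_cst D k : 0 < D -> laplace D (fun=> k) = k / D.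
Proof.
move=> D0; have D1 : D != 0 by rewrite gt_eqF.
have -> : (fun=> k) = (fun t : R => (k / 2) * ((fun t => 1 + cos (0 * t)) t)).
  by apply/funext => t; rewrite mul0r cos0; field.
rewrite laplaceZ//; last by apply: tameD; [exact: tame_cst|exact: tame_cos].
rewrite /laplace /Rintegral laplace_1cos//=.
by field.
Qed.

Lemma laplace_cos D lam : 0 < D ->
  laplace D (fun t => cos (lam * t)) = D / (D ^+ 2 + lam ^+ 2).
Proof.
move=> D0.
have h : laplace D (fun t => 1 + cos (lam * t)) = D^-1 + D / (D ^+ 2 + lam ^+ 2).
  by rewrite /laplace /Rintegral laplace_1cos.
move: h; rewrite laplaceD//; [|exact: tame_cst|exact: tame_cos].
by rewrite laplace_cst// div1r => /addrI.
Qed.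

Lemma laplace_sum D (I : Type) (r : seq I) (P : pred I) (F : I -> R -> R) :
  0 < D -> (forall i, tame (F i)) ->
  laplace D (fun t => \sum_(i <- r | P i) F i t) = \sum_(i <- r | P i) laplace D (F i).
Proof.
move=> D0 tF; elim: r => [|i r IH].
  by under eq_fun do rewrite big_nil; rewrite laplace_cst// mul0r big_nil.
under eq_fun do rewrite big_cons.
rewrite big_cons; case: (P i) => //; rewrite -IH laplaceD//.
exact: tame_sum.
Qed.

Lemma tame_oneDsqr : tame (fun t => 1 + t ^+ 2).
Proof.
split.
  apply: continuous_measurableW => t.
  by apply/differentiable_continuous/derivable1_diffP; exact: ex_derive.
by exists 1 => t t0; rewrite mul1r ger0_norm// addr_ge0// sqr_ge0.
Qed.

Lemma laplace_oneDsqr D : 0 < D <= 1 ->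
  laplace D (fun t => 1 + t ^+ 2) <= 18 / D ^+ 3.
Proof.
move=> /andP[D0 D1].
have D20 : 0 < D / 2 by rewrite divr_gt0.
apply: (@le_trans _ _ (laplace (D / 2) (fun=> 1 + 8 / D ^+ 2))); last first.
  rewrite laplace_cst//.
  have -> : (1 + 8 / D ^+ 2) / (D / 2) = (2 * D ^+ 2 + 16) / D ^+ 3.
    by field; rewrite gt_eqF.
  rewrite ler_pM2r ?invr_gt0 ?exprn_gt0//.
  have : D ^+ 2 <= 1 by rewrite expr_le1// ltW.
  by lra.
apply: le_Rintegral; [exact: measurable_itv| |  |].
- by apply: tame_integrable => //; exact: tame_oneDsqr.
- by apply: tame_integrable => //; exact: tame_cst.
- by move=> t; rewrite /= in_itv/= andbT => t0; exact: oneDsqr_le_expR.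
Qed.

End LaplaceIntegral.

(** * The Poisson kernel and Schur's test *)

Section PoissonKernel.
Context {R : realType}.
Implicit Types (D xi x y a b t : R) (lam mu c : nat -> R).

Lemma mvt (f df : R -> R) a b : a <= b -> (forall x, is_derive x 1 f (df x)) ->
  exists2 c, a <= c <= b & f b - f a = df c * (b - a).
Proof.
move=> ab fdf; have [|c] := MVT_segment ab (fun x _ => fdf x); last by exists c.
by apply: derivable_within_continuous => x _; case: (fdf x).
Qed.

Definition kern D xi := D / (D ^+ 2 + xi ^+ 2).

Lemma kern_den_gt0 D xi : 0 < D -> 0 < D ^+ 2 + xi ^+ 2.
Proof. by move=> D0; rewrite ltr_wpDr ?sqr_ge0 ?exprn_gt0. Qed.

Lemma kern_gt0 D xi : 0 < D -> 0 < kern D xi.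
Proof. by move=> D0; rewrite divr_gt0// kern_den_gt0. Qed.

Lemma kernN D xi : kern D (- xi) = kern D xi.
Proof. by rewrite /kern sqrrN. Qed.

(** From xi^2 <= 2 y^2 + 2 (y - xi)^2 follows D^2 + xi^2 <= 3 (D^2 + y^2): the kernel is essentially
    constant at scale D. *)
Lemma kern_near D xi y : 0 < D -> `|y - xi| <= D -> kern D y <= 3 * kern D xi.
Proof.
move=> D0 yD; rewrite /kern mulrA (mulrC 3) -mulrA ler_pM2l//.
rewrite -[3]invrK -invfM lef_pV2 ?posrE ?mulr_gt0 ?invr_gt0 ?kern_den_gt0//.
rewrite ler_pdivrMl//.
have : (y - xi) ^+ 2 <= D ^+ 2.
  by rewrite -[(y - xi) ^+ 2]real_normK ?num_real// ler_sqr ?nnegrE ?(ltW D0).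
have := sqr_ge0 (2 * y - xi); nra.
Qed.

Definition dkern D xi := - (2 * D * xi) / (D ^+ 2 + xi ^+ 2) ^+ 2.
Definition d2kern D xi := (6 * D * xi ^+ 2 - 2 * D ^+ 3) / (D ^+ 2 + xi ^+ 2) ^+ 3.

Lemma is_derive_kern D xi : 0 < D -> is_derive xi 1 (kern D) (dkern D xi).
Proof.
move=> D0; have h := kern_den_gt0 xi D0.
have h1 : D ^+ 2 + xi ^+ 2 != 0 by rewrite gt_eqF.
rewrite /kern /dkern; apply: is_derive_eq; rewrite /GRing.scale /=.
by field.
Qed.

Lemma is_derive_dkern D xi : 0 < D -> is_derive xi 1 (dkern D) (d2kern D xi).
Proof.
move=> D0; have h := kern_den_gt0 xi D0.
have h1 : D ^+ 2 + xi ^+ 2 != 0 by rewrite gt_eqF.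
have h2 : (D ^+ 2 + xi ^+ 2) ^+ 2 != 0 by rewrite expf_neq0.
rewrite /d2kern /dkern; apply: is_derive_eq; rewrite /GRing.scale /=.
by field.
Qed.

Lemma d2kern_le D xi : 0 < D -> `|d2kern D xi| <= 6 / D ^+ 2 * kern D xi.
Proof.
move=> D0; have h := kern_den_gt0 xi D0.
have D2 : 0 < D ^+ 2 by rewrite exprn_gt0.
rewrite /d2kern /kern normrM [`|_^-1|]gtr0_norm ?invr_gt0 ?exprn_gt0//.
rewrite ler_pdivrMr ?exprn_gt0//.
have -> : 6 / D ^+ 2 * (D / (D ^+ 2 + xi ^+ 2)) * (D ^+ 2 + xi ^+ 2) ^+ 3
  = 6 / D ^+ 2 * D * (D ^+ 2 + xi ^+ 2) ^+ 2 by field; rewrite !gt_eqF.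
apply: (@le_trans _ _ (6 * D * (D ^+ 2 + xi ^+ 2))).
  have p1 : 0 <= D * xi ^+ 2 by rewrite mulr_ge0 ?sqr_ge0// ltW.
  have p2 : 0 < D * D ^+ 2 by rewrite mulr_gt0.
  have -> : D ^+ 3 = D * D ^+ 2 by ring.
  by rewrite ler_norml; apply/andP; split; lra.
have -> : 6 / D ^+ 2 * D * (D ^+ 2 + xi ^+ 2) ^+ 2
  = 6 * D * (D ^+ 2 + xi ^+ 2) * ((D ^+ 2 + xi ^+ 2) / D ^+ 2) by field; rewrite gt_eqF.
rewrite ler_peMr ?mulr_ge0 ?(ltW D0) ?(ltW h)//.
by rewrite ler_pdivlMr// mul1r lerDl sqr_ge0.
Qed.

(** Two applications of the mean value theorem produce a b times the second derivative at a point
    within D of xi. The 18 is the 6 of [d2kern_le] times the 3 of [kern_near]. *)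
Lemma kern_diff2 D xi a b : 0 < D -> 0 <= a <= D -> 0 <= b <= D ->
  `|kern D xi - kern D (xi - b) - kern D (xi + a) + kern D (xi + a - b)|
  <= 18 / D ^+ 2 * (a * b) * kern D xi.
Proof.
move=> D0 /andP[a0 aD] /andP[b0 bD].
pose f (s : R) : R := kern D (xi + s) - kern D (xi + s - b).
pose df (s : R) : R := dkern D (xi + s) - dkern D (xi + s - b).
have fdf (s : R) : is_derive s 1 f (df s).
  have h1 := is_derive_kern (xi + s) D0.
  have h2 := is_derive_kern (xi + s - b) D0.
  have -> : df s = df s * 1 by rewrite mulr1.
  rewrite /f /df mulrBl; apply: is_deriveB.
    apply: (@is_derive1_comp _ (kern D)); by apply: is_derive_eq; rewrite ?subr0 add0r.
  apply: (@is_derive1_comp _ (kern D)); by apply: is_derive_eq; rewrite ?subr0 add0r.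
have [s0 /andP[s00 s0a]] := mvt a0 fdf.
have le0 : xi + s0 - b <= xi + s0 by rewrite lerBlDr lerDl.
have [s1 /andP[s1l s1r]] := mvt le0 (fun x => is_derive_dkern x D0).
move=> e1; rewrite subr0 /df e1.
have -> : kern D xi - kern D (xi - b) - kern D (xi + a) + kern D (xi + a - b)
  = - (f a - f 0) by rewrite /f addr0; ring.
move=> ->; rewrite normrN.
have -> : d2kern D s1 * (xi + s0 - (xi + s0 - b)) * a = (a * b) * d2kern D s1 by ring.
rewrite normrM ger0_norm ?mulr_ge0//.
have -> : 18 / D ^+ 2 * (a * b) * kern D xi = a * b * (18 / D ^+ 2 * kern D xi) by ring.
rewrite ler_wpM2l ?mulr_ge0//.
apply: le_trans (d2kern_le s1 D0) _.
have -> : 18 / D ^+ 2 * kern D xi = 6 / D ^+ 2 * (3 * kern D xi) by ring.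
rewrite ler_wpM2l ?divr_ge0 ?exprn_ge0 ?(ltW D0)//.
apply: kern_near => //; rewrite ler_norml; apply/andP; split; lra.
Qed.

(* A step at most [D] changes [kern D] by a factor at most 3, so the sum is
   compared with the increments of [atan]. *)
Lemma kern_row_sum D lam y m n : 0 < D ->
  (forall k, (m <= k)%N -> 0 <= lam k.+1 - lam k <= D) ->
  \sum_(m <= k < n) (lam k.+1 - lam k) * kern D (lam k - y) <= 3 * pi.
Proof.
move=> D0 hl.
have [mn|nm] := leqP m n; last by rewrite big_geq ?mulr_ge0 ?pi_ge0// ltnW.
pose f k := atan ((lam k - y) / D).
apply: (@le_trans _ _ (\sum_(m <= k < n) 3 * (f k.+1 - f k))); last first.
  rewrite -mulr_sumr telescope_sumr// ler_pM2l// /f.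
  have := atan_ltpi2 ((lam n - y) / D); have := atan_gtNpi2 ((lam m - y) / D); lra.
apply: ler_sum_nat => k /andP[mk _].
have /andP[h0 hD] := hl k mk.
have le0 : (lam k - y) / D <= (lam k.+1 - y) / D.
  by rewrite ler_pM2r ?invr_gt0//; lra.
have [z /andP[zl zr]] := mvt le0 (@is_derive1_atan R).
rewrite -/(f k) -/(f k.+1) => ->.
have -> : 3 * ((1 + z ^+ 2)^-1 * ((lam k.+1 - y) / D - (lam k - y) / D))
  = (lam k.+1 - lam k) * (3 * kern D (D * z)).
  have n1 : 1 + z ^+ 2 != 0 by rewrite gt_eqF// ltr_wpDr ?sqr_ge0.
  have n2 : D != 0 by rewrite gt_eqF.
  rewrite /kern (_ : D ^+ 2 + (D * z) ^+ 2 = D * (D * (1 + z ^+ 2))); last by ring.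
  by field; rewrite n1 n2.
rewrite ler_wpM2l//.
apply: kern_near => //.
move: zl zr; rewrite ler_pdivrMr// ler_pdivlMr// => zl zr.
rewrite ler_norml; apply/andP; split; lra.
Qed.

(** By the inequality of arithmetic and geometric means, 2 |c_i c_j| <= c_i^2 h_j / h_i + c_j^2 h_i
    / h_j; symmetry of [K] makes the two resulting sums equal, and the row bound evaluates either.
    The weight [h] is left free: the frequency gap in one use, the constant 1 in another. *)
Lemma schur_test (K : nat -> nat -> R) (c h B : nat -> R) m n :
  (forall i j, (m <= i < n)%N -> (m <= j < n)%N -> K i j = K j i) ->
  (forall i j, (m <= i < n)%N -> (m <= j < n)%N -> 0 <= K i j) ->
  (forall i, (m <= i < n)%N -> 0 < h i) ->
  (forall i, (m <= i < n)%N -> \sum_(m <= j < n) h j * K i j <= B i) ->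
  \sum_(m <= i < n) \sum_(m <= j < n) `|c i| * `|c j| * K i j
  <= \sum_(m <= i < n) c i ^+ 2 / h i * B i.
Proof.
move=> Ksym K0 h0 rowB.
pose A := \sum_(m <= i < n) \sum_(m <= j < n) c i ^+ 2 / h i * (h j * K i j).
have AB : A <= \sum_(m <= i < n) c i ^+ 2 / h i * B i.
  apply: ler_sum_nat => i mi.
  rewrite -mulr_sumr ler_wpM2l ?rowB//.
  by rewrite divr_ge0 ?sqr_ge0// ltW// h0.
apply: le_trans AB.
have -> : A = 2^-1 * (A + A) by field.
have AE : A = \sum_(m <= i < n) \sum_(m <= j < n) c j ^+ 2 / h j * (h i * K j i).
  by rewrite /A exchange_big_nat.
rewrite {2}AE {1}/A -big_split /= mulr_sumr.
apply: ler_sum_nat => i mi; rewrite -big_split /= mulr_sumr.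
apply: ler_sum_nat => j mj.
rewrite (Ksym j i)//.
have hi := h0 _ mi; have hj := h0 _ mj.
have -> : 2^-1 * (c i ^+ 2 / h i * (h j * K i j) + c j ^+ 2 / h j * (h i * K i j))
  = (2^-1 * (c i ^+ 2 / h i * h j + c j ^+ 2 / h j * h i)) * K i j by ring.
rewrite ler_wpM2r ?K0//.
have q0 : 0 < h i * h j by rewrite mulr_gt0.
rewrite -(ler_pM2r q0).
have -> : 2^-1 * (c i ^+ 2 / h i * h j + c j ^+ 2 / h j * h i) * (h i * h j)
  = 2^-1 * ((c i * h j) ^+ 2 + (c j * h i) ^+ 2) by field; rewrite !gt_eqF.
rewrite -[(c i * h j) ^+ 2]real_normK ?num_real// -[(c j * h i) ^+ 2]real_normK ?num_real//.
rewrite !normrM (gtr0_norm hi) (gtr0_norm hj).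
have := sqr_ge0 (`|c i| * h j - `|c j| * h i).
by nra.
Qed.

(** With the gaps as Schur weights, a weighted row is a Riemann sum of the Poisson kernel, whose
    total mass is pi; gaps at most D keep that sum within a factor 3 of the integral. *)
Lemma kern_form_le D lam c m n : 0 < D ->
  (forall k, (m <= k)%N -> 0 < lam k.+1 - lam k <= D) ->
  \sum_(m <= i < n) \sum_(m <= j < n) `|c i| * `|c j| * kern D (lam i - lam j)
  <= 3 * pi * \sum_(m <= i < n) c i ^+ 2 / (lam i.+1 - lam i).
Proof.
move=> D0 hl; rewrite mulrC mulr_suml; apply: schur_test.
- by move=> i j _ _; rewrite -kernN opprB.
- by move=> i j _ _; rewrite ltW// kern_gt0.
- by move=> i /andP[mi _]; have /andP[] := hl i mi.
move=> i mi; under eq_bigr do rewrite -kernN opprB.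
apply: kern_row_sum => // k mk; have /andP[h1 ->] := hl k mk.
by rewrite ltW.
Qed.

End PoissonKernel.

(** * Mean squares of trigonometric sums *)

Section TrigSums.
Context {R : realType}.
Implicit Types (D a b x y t : R) (lam mu c : nat -> R) (z w : R[i]).

Definition nsq z : R := complex.Re z ^+ 2 + complex.Im z ^+ 2.

Lemma nsq_ge0 z : 0 <= nsq z.
Proof. by rewrite addr_ge0 ?sqr_ge0. Qed.

Lemma normc_sqr z : Normc.normc z ^+ 2 = nsq z.
Proof. by case: z => a b; rewrite /nsq /= sqr_sqrtr// addr_ge0 ?sqr_ge0. Qed.

Lemma nsqM z w : nsq (z * w) = nsq z * nsq w.
Proof. by case: z w => a b [c d]; rewrite /nsq /=; ring. Qed.

(** The free parameter keeps the coefficient of the main part as close to 1 as desired, at the price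
    of 1 / e on the error; this is how cross terms are handled without being computed. *)
Lemma nsqD_le (e : R) z w : 0 < e ->
  nsq (z + w) <= (1 + e) * nsq z + (1 + e^-1) * nsq w.
Proof.
move=> e0; case: z w => a b [c d]; rewrite /nsq /=.
have h (u v : R) : (u + v) ^+ 2 <= (1 + e) * u ^+ 2 + (1 + e^-1) * v ^+ 2.
  rewrite -subr_ge0.
  have -> : (1 + e) * u ^+ 2 + (1 + e^-1) * v ^+ 2 - (u + v) ^+ 2
    = e^-1 * (e * u - v) ^+ 2 by field; rewrite gt_eqF.
  by rewrite mulr_ge0 ?sqr_ge0// invr_ge0 ltW.
have := h a c; have := h b d; lra.
Qed.

Lemma nsqD2 z w : nsq (z + w) <= 2 * nsq z + 2 * nsq w.
Proof. by have := nsqD_le z w (ltr01 : 0 < (1 : R)); rewrite invr1. Qed.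

Lemma nsqN z : nsq (- z) = nsq z.
Proof. by case: z => a b; rewrite /nsq /= !sqrrN. Qed.

Lemma Re_sum (I : Type) (r : seq I) (P : pred I) (F : I -> R[i]) :
  complex.Re (\sum_(i <- r | P i) F i) = \sum_(i <- r | P i) complex.Re (F i).
Proof. by apply: (big_morph (@complex.Re R)) => // -[a b] [c d]. Qed.

Lemma Im_sum (I : Type) (r : seq I) (P : pred I) (F : I -> R[i]) :
  complex.Im (\sum_(i <- r | P i) F i) = \sum_(i <- r | P i) complex.Im (F i).
Proof. by apply: (big_morph (@complex.Im R)) => // -[a b] [c d]. Qed.

(* [a exp (- i y)]; [wave (rsqrt n) (ln n * t)] below is [n^-s] at s = 1/2 + i t. *)
Definition wave a y : R[i] := Complex (a * cos y) (- (a * sin y)).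

Lemma nsq_wave a y : nsq (wave a y) = a ^+ 2.
Proof.
rewrite /nsq /=; have := cos2Dsin2 y.
have -> : (a * cos y) ^+ 2 + (- (a * sin y)) ^+ 2 = a ^+ 2 * (cos y ^+ 2 + sin y ^+ 2) by ring.
by move=> ->; rewrite mulr1.
Qed.

Lemma nsq_sum m n (F : nat -> R[i]) :
  nsq (\sum_(m <= j < n) F j) =
  \sum_(m <= i < n) \sum_(m <= j < n)
    (complex.Re (F i) * complex.Re (F j) + complex.Im (F i) * complex.Im (F j)).
Proof.
rewrite /nsq Re_sum Im_sum !expr2 !big_distrlr /= -big_split /=.
by apply: eq_bigr => i _; rewrite -big_split.
Qed.

Lemma nsq_wave_sum m n c lam t :
  nsq (\sum_(m <= j < n) wave (c j) (lam j * t)) =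
  \sum_(m <= i < n) \sum_(m <= j < n) c i * c j * cos ((lam i - lam j) * t).
Proof.
rewrite nsq_sum; apply: eq_bigr => i _; apply: eq_bigr => j _ /=.
by rewrite mulrBl cosB; ring.
Qed.

Lemma nsq_wave_diff_sum m n c lam mu t :
  nsq (\sum_(m <= j < n) (wave (c j) (lam j * t) - wave (c j) (mu j * t))) =
  \sum_(m <= i < n) \sum_(m <= j < n) c i * c j *
    (cos ((lam i - lam j) * t) - cos ((lam i - mu j) * t)
     - cos ((mu i - lam j) * t) + cos ((mu i - mu j) * t)).
Proof.
rewrite nsq_sum; apply: eq_bigr => i _; apply: eq_bigr => j _ /=.
by rewrite !mulrBl !cosB; ring.
Qed.

Lemma tame_wave_sum m n c lam :
  tame (fun t => nsq (\sum_(m <= j < n) wave (c j) (lam j * t))).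
Proof.
under eq_fun do rewrite nsq_wave_sum.
by apply: tame_sum => i; apply: tame_sum => j; apply: tameZ; exact: tame_cos.
Qed.

Let tame_cos4 a1 a2 a3 a4 :
  tame (fun t => cos (a1 * t) - cos (a2 * t) - cos (a3 * t) + cos (a4 * t)).
Proof.
have -> : (fun t : R => cos (a1 * t) - cos (a2 * t) - cos (a3 * t) + cos (a4 * t)) =
  (fun t => cos (a1 * t) + (-1) * cos (a2 * t) + (-1) * cos (a3 * t) + cos (a4 * t)).
  by apply/funext => t; rewrite !mulN1r.
by do ![apply: tameD|apply: tameZ|exact: tame_cos].
Qed.

Lemma tame_wave_diff_sum m n c lam mu :
  tame (fun t => nsq (\sum_(m <= j < n) (wave (c j) (lam j * t) - wave (c j) (mu j * t)))).
Proof.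
under eq_fun do rewrite nsq_wave_diff_sum.
by apply: tame_sum => i; apply: tame_sum => j; apply: tameZ; exact: tame_cos4.
Qed.

Lemma laplace_wave_sum D m n c lam : 0 < D ->
  laplace D (fun t => nsq (\sum_(m <= j < n) wave (c j) (lam j * t))) =
  \sum_(m <= i < n) \sum_(m <= j < n) c i * c j * kern D (lam i - lam j).
Proof.
move=> D0; under eq_fun do rewrite nsq_wave_sum.
rewrite laplace_sum//; last first.
  by move=> i; apply: tame_sum => j; apply: tameZ; exact: tame_cos.
apply: eq_bigr => i _; rewrite laplace_sum//; last first.
  by move=> j; apply: tameZ; exact: tame_cos.
apply: eq_bigr => j _; rewrite laplaceZ//; last exact: tame_cos.
by rewrite laplace_cos.
Qed.

Lemma laplace_wave_diff_sum D m n c lam mu : 0 < D ->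
  laplace D (fun t => nsq (\sum_(m <= j < n) (wave (c j) (lam j * t) - wave (c j) (mu j * t)))) =
  \sum_(m <= i < n) \sum_(m <= j < n) c i * c j *
    (kern D (lam i - lam j) - kern D (lam i - mu j) - kern D (mu i - lam j) + kern D (mu i - mu j)).
Proof.
move=> D0; under eq_fun do rewrite nsq_wave_diff_sum.
rewrite laplace_sum//; last by move=> i; apply: tame_sum => j; apply: tameZ.
apply: eq_bigr => i _; rewrite laplace_sum//; last by move=> j; apply: tameZ.
apply: eq_bigr => j _; rewrite laplaceZ//.
congr (_ * _).
have -> : (fun t : R => cos ((lam i - lam j) * t) - cos ((lam i - mu j) * t)
     - cos ((mu i - lam j) * t) + cos ((mu i - mu j) * t)) =
  (fun t => cos ((lam i - lam j) * t) + (-1) * cos ((lam i - mu j) * t)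
     + (-1) * cos ((mu i - lam j) * t) + cos ((mu i - mu j) * t)).
  by apply/funext => t; rewrite !mulN1r.
do 3 (rewrite laplaceD//; try by do ![apply: tameD|apply: tameZ|exact: tame_cos]).
rewrite !laplaceZ//; try exact: tame_cos.
by rewrite !laplace_cos// !mulN1r.
Qed.

Lemma laplace_wave_sum_le D m n c lam : 0 < D ->
  (forall k, (m <= k)%N -> 0 < lam k.+1 - lam k <= D) ->
  laplace D (fun t => nsq (\sum_(m <= j < n) wave (c j) (lam j * t)))
  <= 3 * pi * \sum_(m <= i < n) c i ^+ 2 / (lam i.+1 - lam i).
Proof.
move=> D0 hl; rewrite laplace_wave_sum//.
apply: le_trans (kern_form_le c n D0 hl).
apply: ler_sum => i _; apply: ler_sum => j _.
by rewrite ler_wpM2r ?(ltW (kern_gt0 _ _))// -normrM ler_norm.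
Qed.

(** Each of the two factors of the square contributes one difference of phases, so every entry is a
    second difference of the kernel. [kern_diff2] turns it into the product of the two shifts, which
    is absorbed in the coefficients, and the form in [kern] at the frequencies [lam] is left. *)
Lemma laplace_wave_diff_sum_le D m n c lam mu : 0 < D ->
  (forall k, (m <= k)%N -> 0 < lam k.+1 - lam k <= D) ->
  (forall k, (m <= k)%N -> 0 <= mu k - lam k <= D) ->
  laplace D (fun t => nsq (\sum_(m <= j < n) (wave (c j) (lam j * t) - wave (c j) (mu j * t))))
  <= 18 / D ^+ 2 * (3 * pi * \sum_(m <= i < n) (c i * (mu i - lam i)) ^+ 2 / (lam i.+1 - lam i)).
Proof.
move=> D0 hl hm; rewrite laplace_wave_diff_sum//.
have D2 : 0 < 18 / D ^+ 2 by rewrite divr_gt0// exprn_gt0.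
rewrite -ler_pdivrMl//.
apply: le_trans (kern_form_le (fun i => c i * (mu i - lam i)) n D0 hl).
rewrite mulr_sumr; apply: ler_sum_nat => i /andP[mi _].
rewrite mulr_sumr; apply: ler_sum_nat => j /andP[mj _].
have /andP[hi0 hiD] := hm i mi; have /andP[hj0 hjD] := hm j mj.
rewrite ler_pdivrMl// !normrM (ger0_norm hi0) (ger0_norm hj0).
apply: le_trans (ler_norm _) _; rewrite normrM normrM.
have -> : 18 / D ^+ 2 * (`|c i| * (mu i - lam i) * (`|c j| * (mu j - lam j)) * kern D (lam i - lam j))
  = `|c i| * `|c j| * (18 / D ^+ 2 * ((mu i - lam i) * (mu j - lam j)) * kern D (lam i - lam j)) by ring.
rewrite ler_wpM2l ?mulr_ge0//.
have := @kern_diff2 R D (lam i - lam j) (mu i - lam i) (mu j - lam j) D0.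
rewrite hi0 hiD hj0 hjD => /(_ isT isT).
rewrite (_ : lam i - lam j - (mu j - lam j) = lam i - mu j); last by ring.
rewrite (_ : lam i - lam j + (mu i - lam i) = mu i - lam j); last by ring.
by rewrite (_ : mu i - lam j - (mu j - lam j) = mu i - mu j); last by ring.
Qed.

End TrigSums.

(** * Approximation of zeta on the critical line *)

Section ZetaApprox.
Context {R : realType}.
Implicit Types (a b u v w t : R) (n m : nat).

(** The sequence x + b is nonincreasing and bounded below, hence convergent, and b tends to 0. The
    majorant b is then also the explicit rate of convergence. *)
Lemma telescoping_cvg (x b : nat -> R) :
  (forall n, 0 <= b n) -> b @ \oo --> (0 : R) ->
  (forall n, (0 < n)%N -> `|x n.+1 - x n| <= b n - b n.+1) ->
  exists L : R, x @ \oo --> L /\ forall n, (0 < n)%N -> `|L - x n| <= b n.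
Proof.
move=> b0 bcv xb.
have step n : (0 < n)%N -> forall k, `|x (n + k)%N - x n| <= b n - b (n + k)%N.
  move=> n0; elim=> [|k IH]; first by rewrite addn0 !subrr normr0.
  have := xb (n + k)%N (ltn_addr _ n0); rewrite -addnS => h.
  have -> : x (n + k.+1)%N - x n = (x (n + k.+1)%N - x (n + k)%N) + (x (n + k)%N - x n) by ring.
  apply: le_trans (ler_normD _ _) _; lra.
have ub n k : (0 < n)%N -> (n <= k)%N -> `|x k - x n| <= b n.
  move=> n0 nk; have := step n n0 (k - n)%N; rewrite subnKC// => /le_trans; apply.
  by rewrite lerBlDr lerDl.
pose y n := x n.+1 + b n.+1.
have [L yL] : exists L : R, y @ \oo --> L.
  suff : cvgn y by exists (limn y).
  apply: nonincreasing_is_cvgn.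
    apply/nonincreasing_seqP => n; rewrite /y.
    have := xb n.+1 isT; rewrite ler_norml => /andP[_]; lra.
  exists (x 1%N - b 1%N) => _ [n _ <-]; rewrite /y.
  have := ub 1%N n.+1 isT isT; rewrite ler_norml => /andP[]; have := b0 n.+1; lra.
have xL : x @ \oo --> L.
  rewrite -cvg_shiftS.
  have -> : [sequence x n.+1]_n = (fun n => y n - b n.+1).
    by apply/funext => n; rewrite /y /= addrK.
  rewrite -[L]subr0; apply: cvgB => //.
  by move: bcv; rewrite -cvg_shiftS.
exists L; split=> // n n0.
apply: (@cvgr_to_le _ \oo _ _ (fun k => `|x k - x n|)).
  by apply: cvg_norm; apply: cvgB => //; exact: cvg_cst.
by exists n => // k /= nk; exact: ub.
Qed.

Definition rsqrt n : R := (Num.sqrt n%:R)^-1.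

Lemma rsqrt_gt0 n : (0 < n)%N -> 0 < rsqrt n.
Proof. by move=> n0; rewrite invr_gt0 sqrtr_gt0 ltr0n. Qed.

Lemma rsqrt_sqr n : rsqrt n ^+ 2 = n%:R^-1.
Proof. by rewrite exprVn sqr_sqrtr. Qed.

Lemma rsqrt_expR n : (0 < n)%N -> rsqrt n = expR (- (ln n%:R / 2)).
Proof.
move=> n0; have h : (0 : R) < n%:R by rewrite ltr0n.
by rewrite expRN /rsqrt -powR12_sqrt ?ler0n// /powR gt_eqF// mulrC.
Qed.

Lemma rsqrt_cvg : rsqrt n @[n --> \oo] --> (0 : R).
Proof.
apply/cvgrPdist_lt => e e0; near=> n.
have n0 : (0 < n)%N by near: n; exists 1%N.
rewrite sub0r normrN gtr0_norm ?rsqrt_gt0//.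
rewrite -(ltr_pXn2r (_ : (0 < 2)%N)) ?nnegrE ?(ltW e0) ?(ltW (rsqrt_gt0 _))//.
rewrite rsqrt_sqr invf_plt ?posrE ?ltr0n ?exprn_gt0//.
near: n; exact: nbhs_infty_gtr.
Unshelve. all: by end_near. Qed.

Lemma rsqrtB n (p := Num.sqrt n%:R) (q := Num.sqrt n.+1%:R) : (0 < n)%N ->
  rsqrt n - rsqrt n.+1 = (p * q * (p + q))^-1.
Proof.
move=> n0; rewrite /rsqrt -/p -/q.
have p0 : 0 < p by rewrite sqrtr_gt0 ltr0n.
have q0 : 0 < q by rewrite sqrtr_gt0 ltr0n.
have q2 : q ^+ 2 = p ^+ 2 + 1 by rewrite !sqr_sqrtr// natr1.
have e : (q - p) * (q + p) = 1 by rewrite -subr_sqr q2 addrC addKr.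
have pq0 : p + q != 0 by rewrite gt_eqF// addr_gt0.
apply: (@mulIf _ (p * q * (p + q))); first by rewrite !mulf_neq0// gt_eqF.
rewrite mulVf ?mulf_neq0 ?gt_eqF//; last by rewrite addr_gt0.
by rewrite -e; field; rewrite !gt_eqF.
Qed.

(** Errors of order n^-(3/2) are put in telescoping form, as [telescoping_cvg] wants them. Since
    sqrt (n + 1) <= 3/2 sqrt n, the constant 15/4 would do. *)
Lemma rsqrt_tele n : (0 < n)%N ->
  n%:R^-1 * rsqrt n <= 4 * (rsqrt n - rsqrt n.+1).
Proof.
move=> n0; rewrite rsqrtB// /rsqrt.
set p := Num.sqrt n%:R; set q := Num.sqrt n.+1%:R.
have p0 : 0 < p by rewrite sqrtr_gt0 ltr0n.
have q0 : 0 < q by rewrite sqrtr_gt0 ltr0n.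
have p2 : p ^+ 2 = n%:R by rewrite sqr_sqrtr.
have q2 : q ^+ 2 = p ^+ 2 + 1 by rewrite p2 sqr_sqrtr// natr1.
have n1 : 1 <= p ^+ 2 by rewrite p2 ler1n.
rewrite -p2 -invfM -[4]invrK -invfM lef_pV2 ?posrE ?mulr_gt0 ?invr_gt0 ?addr_gt0 ?exprn_gt0//.
rewrite ler_pdivrMl//.
have h : q <= 3 / 2 * p by nra.
nra.
Qed.

Lemma expcos_is_derive a b v :
  is_derive v 1 (fun v => expR (a * v) * cos (b * v))
    (expR (a * v) * (a * cos (b * v) - b * sin (b * v))).
Proof. by apply: is_derive_eq; rewrite /GRing.scale /=; ring. Qed.

Lemma expsin_is_derive a b v :
  is_derive v 1 (fun v => expR (a * v) * sin (b * v))
    (expR (a * v) * (a * sin (b * v) + b * cos (b * v))).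
Proof. by apply: is_derive_eq; rewrite /GRing.scale /=; ring. Qed.

Lemma norm_trig_le t (p q : R) : `|p| <= 1 -> `|q| <= 1 ->
  `|2^-1 * p + t * q| <= 2^-1 + `|t|.
Proof.
move=> hp hq; apply: le_trans (ler_normD _ _) _.
rewrite !normrM ger0_norm//; apply: lerD; first by rewrite ler_piMr.
by rewrite ler_piMr.
Qed.

Lemma cos_norm_le1 v : `|cos v| <= 1.
Proof. by rewrite ler_norml cos_geN1 cos_le1. Qed.

Lemma sin_norm_le1 v : `|sin v| <= 1.
Proof. by rewrite ler_norml sin_geN1 sin_le1. Qed.

(** The two functions are, up to sign, the real and imaginary parts of exp (- s v) at s = 1/2 + i t,
    whose derivative has each part bounded by exp (- v / 2) (1/2 + |t|). *)
Lemma expcos_lip t u v w : u <= v <= w ->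
  `|expR (- (2^-1) * v) * cos (t * v) - expR (- (2^-1) * w) * cos (t * w)| <=
    expR (- (2^-1) * u) * (2^-1 + `|t|) * (w - v) /\
  `|expR (- (2^-1) * v) * sin (t * v) - expR (- (2^-1) * w) * sin (t * w)| <=
    expR (- (2^-1) * u) * (2^-1 + `|t|) * (w - v).
Proof.
move=> /andP[uv vw]; have wv0 : 0 <= w - v by rewrite subr_ge0.
split; rewrite distrC.
- have [x /andP[vx xw] ->] := mvt vw (expcos_is_derive (- (2^-1)) t).
  rewrite normrM [`|w - v|]ger0_norm// ler_wpM2r// normrM ger0_norm ?expR_ge0//.
  apply: ler_pM; rewrite ?expR_ge0 ?ler_expR//; first lra.
  rewrite -normrN (_ : - (- (2^-1) * cos (t * x) - t * sin (t * x)) = 2^-1 * cos (t * x) + t * sin (t * x)); last by ring.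
  by apply: norm_trig_le; [exact: cos_norm_le1|exact: sin_norm_le1].
- have [x /andP[vx xw] ->] := mvt vw (expsin_is_derive (- (2^-1)) t).
  rewrite normrM [`|w - v|]ger0_norm// ler_wpM2r// normrM ger0_norm ?expR_ge0//.
  apply: ler_pM; rewrite ?expR_ge0 ?ler_expR//; first lra.
  rewrite -normrN (_ : - (- (2^-1) * sin (t * x) + t * cos (t * x)) = 2^-1 * sin (t * x) + t * (- cos (t * x))); last by ring.
  by apply: norm_trig_le; rewrite ?normrN; [exact: sin_norm_le1|exact: cos_norm_le1].
Qed.

End ZetaApprox.

(** * Rate of convergence of the sequence defining zeta on the critical line *)

Section ZetaStep.
Context {R : realType}.
Implicit Types (t u v w : R) (n m : nat).

Let X t v : R := expR (- (2^-1) * v) * cos (t * v).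
Let Y t v : R := expR (- (2^-1) * v) * sin (t * v).

Let expR_half v : expR (2^-1 * v) = expR v * expR (- (2^-1) * v).
Proof. by rewrite -expRD; congr expR; field. Qed.

(* Real and imaginary parts of the second order Taylor estimate for
   v |-> exp ((1 - s) v) - (1 - s) exp (- s w) exp v, s = 1/2 + i t,
   whose derivative vanishes at w. *)
Lemma taylor_Re t u w : u <= w ->
  `|(expR w * X t w - (2^-1 * X t w - t * Y t w) * expR w)
    - (expR u * X t u - (2^-1 * X t w - t * Y t w) * expR u)|
  <= expR w * expR (- (2^-1) * u) * (2^-1 + `|t|) ^+ 2 * (w - u) ^+ 2.
Proof.
move=> uw.
pose P := 2^-1 * X t w - t * Y t w.
pose F v := expR (2^-1 * v) * cos (t * v) - P * expR v.
pose dF v := expR v * (2^-1 * (X t v - X t w) + t * - (Y t v - Y t w)).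
have FdF v : is_derive v 1 F (dF v).
  rewrite /F; have := expcos_is_derive (2^-1) t v => h.
  apply: is_derive_eq; rewrite /dF /X /Y /P expR_half /GRing.scale /=; rewrite /X /Y; ring.
have [z /andP[uz zw] e] := mvt uw FdF.
have FE v : expR v * X t v - P * expR v = F v by rewrite /F expR_half /X mulrA.
rewrite -/P !FE e normrM [`|w - u|]ger0_norm ?subr_ge0//.
rewrite normrM ger0_norm ?expR_ge0//.
have [hX hY] := @expcos_lip R t u z w (introT andP (conj uz zw)).
have wu0 : 0 <= w - u by rewrite subr_ge0.
have wz : w - z <= w - u by rewrite lerB.
have T0 : 0 <= 2^-1 + `|t| by rewrite addr_ge0.
set M := expR (- (2^-1) * u) * (2^-1 + `|t|) * (w - u).
have zM : expR (- (2^-1) * u) * (2^-1 + `|t|) * (w - z) <= M.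
  by rewrite ler_wpM2l// mulr_ge0 ?expR_ge0.
have hX' := le_trans hX zM; have hY' := le_trans hY zM.
have -> : expR w * expR (- (2^-1) * u) * (2^-1 + `|t|) ^+ 2 * (w - u) ^+ 2
  = expR w * ((2^-1 + `|t|) * M) * (w - u) by rewrite /M; ring.
rewrite ler_wpM2r//; apply: ler_pM; rewrite ?expR_ge0 ?ler_expR//.
apply: le_trans (ler_normD _ _) _; rewrite !normrM normrN ger0_norm// mulrDl.
by apply: lerD; rewrite ler_wpM2l.
Qed.

Lemma taylor_Im t u w : u <= w ->
  `|(- (expR w * Y t w) + (2^-1 * Y t w + t * X t w) * expR w)
    - (- (expR u * Y t u) + (2^-1 * Y t w + t * X t w) * expR u)|
  <= expR w * expR (- (2^-1) * u) * (2^-1 + `|t|) ^+ 2 * (w - u) ^+ 2.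
Proof.
move=> uw.
pose P := 2^-1 * Y t w + t * X t w.
pose F v := - (expR (2^-1 * v) * sin (t * v)) + P * expR v.
pose dF v := expR v * (2^-1 * - (Y t v - Y t w) + t * - (X t v - X t w)).
have FdF v : is_derive v 1 F (dF v).
  rewrite /F; have := expsin_is_derive (2^-1) t v => h.
  apply: is_derive_eq; rewrite /dF /X /Y /P expR_half /GRing.scale /=; rewrite /X /Y; ring.
have [z /andP[uz zw] e] := mvt uw FdF.
have FE v : - (expR v * Y t v) + P * expR v = F v by rewrite /F expR_half /Y mulrA.
rewrite -/P !FE e normrM [`|w - u|]ger0_norm ?subr_ge0//.
rewrite normrM ger0_norm ?expR_ge0//.
have [hX hY] := @expcos_lip R t u z w (introT andP (conj uz zw)).
have wu0 : 0 <= w - u by rewrite subr_ge0.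
have wz : w - z <= w - u by rewrite lerB.
have T0 : 0 <= 2^-1 + `|t| by rewrite addr_ge0.
set M := expR (- (2^-1) * u) * (2^-1 + `|t|) * (w - u).
have zM : expR (- (2^-1) * u) * (2^-1 + `|t|) * (w - z) <= M.
  by rewrite ler_wpM2l// mulr_ge0 ?expR_ge0.
have hX' := le_trans hX zM; have hY' := le_trans hY zM.
have -> : expR w * expR (- (2^-1) * u) * (2^-1 + `|t|) ^+ 2 * (w - u) ^+ 2
  = expR w * ((2^-1 + `|t|) * M) * (w - u) by rewrite /M; ring.
rewrite ler_wpM2r//; apply: ler_pM; rewrite ?expR_ge0 ?ler_expR//.
apply: le_trans (ler_normD _ _) _; rewrite !normrM !normrN ger0_norm// mulrDl.
by apply: lerD; rewrite ler_wpM2l.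
Qed.

Definition zpart n t : R[i] := \sum_(1 <= m < n.+1) cpow m%:R (- critical_line t).

Definition zapprox n t : R[i] :=
  zpart n t - cpow n%:R (1 - critical_line t) / (1 - critical_line t).

Lemma cpow_wave n t : (0 < n)%N ->
  cpow n%:R (- critical_line t) = wave (rsqrt n) (ln n%:R * t).
Proof.
move=> n0; have h : (0 : R) < n%:R by rewrite ltr0n.
rewrite /cpow /wave /= powRN powR12_sqrt ?ler0n// !mulNr cosN sinN mulrN.
by rewrite (mulrC t).
Qed.

Lemma cpow_wave1 n t : (0 < n)%N ->
  cpow n%:R (1 - critical_line t) = wave (n%:R * rsqrt n) (ln n%:R * t).
Proof.
move=> n0; have h : (0 : R) < n%:R by rewrite ltr0n.
rewrite /cpow /wave /= sub0r powRD; last by rewrite (gt_eqF h) implybT.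
rewrite powRr1 ?ler0n// powRN powR12_sqrt ?ler0n// mulNr cosN sinN mulrN.
by rewrite (mulrC t).
Qed.

Lemma wave_expR n t : (0 < n)%N ->
  wave (rsqrt n) (ln n%:R * t) = Complex (X t (ln n%:R)) (- Y t (ln n%:R)).
Proof.
by move=> n0; rewrite /wave rsqrt_expR// /X /Y mulNr (mulrC t) (mulrC 2^-1).
Qed.

Lemma nsq_onesub t : nsq (1 - critical_line t) = 4^-1 + t ^+ 2.
Proof. by rewrite /nsq /=; field. Qed.

Lemma onesub_neq0 t : 1 - critical_line t != 0.
Proof.
apply/eqP => h; have := nsq_onesub t; rewrite h /nsq /= expr0n /= addr0.
have := sqr_ge0 t; lra.
Qed.

(** Multiplied by 1 - s, the step is (1 - s) (n+1)^-s - (n+1)^(1-s) + n^(1-s). As exp w - exp u = 1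
    for u = ln n and w = ln (n+1), this is exactly minus the increment estimated by [taylor_Re] and
    [taylor_Im]. Dividing by |1 - s| removes one of the two factors 1/2 + |t|, so the growth in t is
    only linear. *)
Lemma zapprox_step n t : (0 < n)%N ->
  nsq (zapprox n.+1 t - zapprox n t) <= (16 * (2^-1 + `|t|) * (rsqrt n - rsqrt n.+1)) ^+ 2.
Proof.
move=> n0; have nR : (0 : R) < n%:R by rewrite ltr0n.
have nR1 : (0 : R) < n.+1%:R by rewrite ltr0n.
set s1 := 1 - critical_line t.
have s10 : s1 != 0 := onesub_neq0 t.
have q0 : 0 < nsq s1 by rewrite nsq_onesub; have := sqr_ge0 t; lra.
set u := ln n%:R : R; set w := ln n.+1%:R : R.
have uw : u <= w by rewrite ler_ln ?posrE// ler_nat.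
have du : w - u <= n%:R^-1.
  rewrite /u /w -ln_div ?posrE//.
  have -> : n.+1%:R / n%:R = 1 + n%:R^-1 :> R by rewrite -natr1 mulrDl divff ?gt_eqF// mul1r.
  by rewrite le_ln1Dx// (lt_trans (ltrN10 _))// invr_gt0.
have eu : expR u = n%:R by rewrite lnK// posrE.
have ew : expR w = n.+1%:R by rewrite lnK// posrE.
have E : s1 * (zapprox n.+1 t - zapprox n t) =
    Complex
     (- ((expR w * X t w - (2^-1 * X t w - t * Y t w) * expR w)
    - (expR u * X t u - (2^-1 * X t w - t * Y t w) * expR u)))
     (- ((- (expR w * Y t w) + (2^-1 * Y t w + t * X t w) * expR w)
    - (- (expR u * Y t u) + (2^-1 * Y t w + t * X t w) * expR u))).
  rewrite /zapprox /zpart big_nat_recr//= -/s1.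
  set S := \sum_(_ <= _ < _) _.
  have -> : s1 * (S + cpow n.+1%:R (- critical_line t) - cpow n.+1%:R s1 / s1 -
    (S - cpow n%:R s1 / s1)) = s1 * cpow n.+1%:R (- critical_line t) - cpow n.+1%:R s1 + cpow n%:R s1.
    by field.
  rewrite /s1 cpow_wave// !cpow_wave1// wave_expR// -/w.
  have wE k : (0 < k)%N -> wave (k%:R * rsqrt k) (ln k%:R * t) =
      Complex (expR (ln k%:R) * X t (ln k%:R)) (- (expR (ln k%:R) * Y t (ln k%:R))).
    move=> k0; have := wave_expR t k0; rewrite /wave => -[<- /oppr_inj<-].
    by rewrite lnK ?posrE ?ltr0n// !mulrA.
  rewrite !wE// -/w -/u /=; have e1 : expR w = expR u + 1 by rewrite eu ew natr1.
  by apply/eqP; rewrite eq_complex /= e1; apply/andP; split; apply/eqP; field.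
rewrite -(ler_pM2l q0) -nsqM E {1}/nsq /=; set dI := _ - _; set dR := _ - _.
rewrite !sqrrN.
pose B := expR w * expR (- 2^-1 * u) * (2^-1 + `|t|) ^+ 2 * (w - u) ^+ 2.
have hR : `|dR| <= B := taylor_Re t uw.
have hI : `|dI| <= B := taylor_Im t uw.
have B0 : 0 <= B by rewrite mulr_ge0 ?sqr_ge0// mulr_ge0 ?sqr_ge0// mulr_ge0 ?expR_ge0.
have sq (d : R) : `|d| <= B -> d ^+ 2 <= B ^+ 2.
  by move=> h; rewrite -[d ^+ 2]real_normK ?num_real// ler_sqr ?nnegrE.
apply: le_trans (lerD (sq _ hR) (sq _ hI)) _.
set T := 2^-1 + `|t| in B B0 hR hI sq *.
have T0 : 0 <= T by rewrite addr_ge0.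
have qT : T ^+ 2 <= 2 * nsq s1.
  rewrite nsq_onesub /T -[t ^+ 2]real_normK ?num_real//.
  have := sqr_ge0 (2^-1 - `|t|); lra.
(* The 8 is the 2 of n + 1 <= 2 n times the 4 of [rsqrt_tele]; adding the real and imaginary parts
   and using T^2 <= 2 |1 - s|^2 doubles it to 16. *)
pose C := 8 * (rsqrt n - rsqrt n.+1) * T ^+ 2.
have BC : B <= C.
  rewrite /B /C ew.
  have -> : expR (- 2^-1 * u) = rsqrt n.
    by rewrite rsqrt_expR// -/u; congr expR; ring.
  have n2 : n.+1%:R <= 2 * n%:R :> R.
    by rewrite -natrM ler_nat mul2n -addnn -addn1 leq_add2l.
  have ww : (w - u) ^+ 2 <= n%:R^-1 ^+ 2.
    by rewrite ler_sqr ?nnegrE ?subr_ge0// invr_ge0 ltW.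
  have := @rsqrt_tele R _ n0.
  have r0 := @rsqrt_gt0 R _ n0.
  move=> tele.
  have h1 : n.+1%:R * rsqrt n * (w - u) ^+ 2 <= 2 * n%:R * rsqrt n * n%:R^-1 ^+ 2.
    apply: ler_pM; rewrite ?sqr_ge0 ?mulr_ge0 ?(ltW r0) ?(ltW nR1)//.
    by rewrite ler_wpM2r// ltW.
  have e2 : 2 * n%:R * rsqrt n * n%:R^-1 ^+ 2 = 2 * (n%:R^-1 * rsqrt n) :> R.
    by field; rewrite gt_eqF.
  rewrite mulrAC [X in _ <= X]mulrC (mulrC _ (T ^+ 2)) ler_wpM2l ?sqr_ge0//.
  lra.
have C0 : 0 <= C by apply: le_trans BC.
apply: (@le_trans _ _ (2 * C ^+ 2)).
  have : B ^+ 2 <= C ^+ 2 by rewrite ler_sqr ?nnegrE.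
  lra.
have -> : 2 * C ^+ 2 = 2^-1 * (T ^+ 2 * (16 * T * (rsqrt n - rsqrt n.+1)) ^+ 2).
  by rewrite /C; field.
rewrite mulrA ler_wpM2r ?sqr_ge0//; lra.
Qed.

Lemma norm_Re_le (z : R[i]) (b : R) : 0 <= b -> nsq z <= b ^+ 2 -> `|complex.Re z| <= b.
Proof.
move=> b0 h; rewrite -(ler_pXn2r (_ : (0 < 2)%N)) ?nnegrE// real_normK ?num_real//.
by apply: le_trans h; rewrite lerDl sqr_ge0.
Qed.

Lemma norm_Im_le (z : R[i]) (b : R) : 0 <= b -> nsq z <= b ^+ 2 -> `|complex.Im z| <= b.
Proof.
move=> b0 h; rewrite -(ler_pXn2r (_ : (0 < 2)%N)) ?nnegrE// real_normK ?num_real//.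
by apply: le_trans h; rewrite lerDr sqr_ge0.
Qed.

Lemma complex_cvg (x : nat -> R[i]) (a b : R) :
  (fun n => complex.Re (x n)) @ \oo --> a -> (fun n => complex.Im (x n)) @ \oo --> b ->
  (x : nat -> R[i]^o) @ \oo --> (Complex a b : R[i]^o).
Proof.
(* The norm takes values in R[i], and a positive radius there has imaginary part 0. *)
move=> ha hb; apply/cvgrPdist_lt => e; rewrite ltcE /= => /andP[/eqP ei er].
have e2 : 0 < complex.Re e / 2 by rewrite divr_gt0.
near=> n.
rewrite ltcE /= ei eqxx /=.
have : `|a - complex.Re (x n)| < complex.Re e / 2.
  by near: n; move/cvgrPdist_lt : ha; apply.
have : `|b - complex.Im (x n)| < complex.Re e / 2.
  by near: n; move/cvgrPdist_lt : hb; apply.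
case: (x n) => c d /= hd hc.
apply: (@le_lt_trans _ _ (`|a - c| + `|b - d|)); last lra.
rewrite -(ler_pXn2r (_ : (0 < 2)%N)) ?nnegrE ?sqrtr_ge0 ?addr_ge0//.
rewrite sqr_sqrtr ?addr_ge0 ?sqr_ge0// -[(a - c) ^+ 2]real_normK ?num_real//.
rewrite -[(b - d) ^+ 2]real_normK ?num_real// sqrrD.
by rewrite -addrA lerD2l lerDr mulrn_wge0// mulr_ge0.
Unshelve. all: by end_near. Qed.

(** The step bounds telescope to 16 (1/2 + |t|) n^-(1/2) for the real and the imaginary part
    separately. This both shows that the [lim] in [zeta] is a genuine limit and gives its rate; 2048
    is a generous round constant. *)
Lemma zeta_approx t : forall n, (0 < n)%N ->
  nsq (zeta (critical_line t) - zapprox n t) <= 2048 * (1 + t ^+ 2) / n%:R.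
Proof.
set T := 2^-1 + `|t|.
have T0 : 0 <= 16 * T by rewrite mulr_ge0// addr_ge0.
pose b n := 16 * T * rsqrt n.
have b0 n : 0 <= b n by rewrite mulr_ge0// invr_ge0 sqrtr_ge0.
have bcv : b @ \oo --> (0 : R).
  by rewrite -[X in _ --> X](mulr0 (16 * T)); apply: cvgMr; exact: rsqrt_cvg.
have db n : (0 < n)%N -> 0 <= b n - b n.+1.
  move=> n0; rewrite -mulrBr mulr_ge0//.
  have := @rsqrt_tele R _ n0; have := @rsqrt_gt0 R _ n0; have : (0 : R) < n%:R^-1 by rewrite invr_gt0 ltr0n.
  by move=> h1 h2; have := mulr_gt0 h1 h2; lra.
have st n : (0 < n)%N -> nsq (zapprox n.+1 t - zapprox n t) <= (b n - b n.+1) ^+ 2.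
  by move=> n0; rewrite /b -mulrBr; exact: zapprox_step.
have [|a [acv ha]] := @telescoping_cvg R (fun n => complex.Re (zapprox n t)) b b0 bcv.
  move=> n n0; have := norm_Re_le (db n n0) (st n n0).
  by case: (zapprox n.+1 t) => ? ?; case: (zapprox n t).
have [|c [ccv hc]] := @telescoping_cvg R (fun n => complex.Im (zapprox n t)) b b0 bcv.
  move=> n n0; have := norm_Im_le (db n n0) (st n n0).
  by case: (zapprox n.+1 t) => ? ?; case: (zapprox n t).
have zE : zeta (critical_line t) = Complex a c.
  exact: (@cvg_lim (R[i]^o) (@norm_hausdorff _ _) _ _ _ _ _ (complex_cvg acv ccv)).
move=> n n0; rewrite zE.
have := ha n n0; have := hc n n0; case: (zapprox n t) => x y /= h1 h2.
rewrite /nsq /=.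
have sq (d : R) : `|d| <= b n -> d ^+ 2 <= b n ^+ 2.
  by move=> h; rewrite -[d ^+ 2]real_normK ?num_real// ler_sqr ?nnegrE.
apply: le_trans (lerD (sq _ h2) (sq _ h1)) _.
rewrite /b !exprMn rsqrt_sqr -mulrDl ler_wpM2r ?invr_ge0// /T.
rewrite -[t ^+ 2]real_normK ?num_real//.
have := sqr_ge0 (2^-1 - `|t|); have := sqr_ge0 `|t|; lra.
Qed.

Lemma zapprox_cvg t : (fun n => nsq (zeta (critical_line t) - zapprox n t)) @ \oo --> (0 : R).
Proof.
apply: (@squeeze_cvgr _ _ _ _ (cst 0) (fun n => 2048 * (1 + t ^+ 2) * n%:R^-1)); first last.
- rewrite -[X in _ --> X](mulr0 (2048 * (1 + t ^+ 2))); apply: cvgMr.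
  apply/gtr0_cvgV0; last exact: cvgr_idn.
  by exists 1%N => // n /= n0; rewrite ltr0n.
- exact: cvg_cst.
near=> n; rewrite nsq_ge0 /=; apply: zeta_approx.
by near: n; exists 1%N.
Unshelve. all: by end_near. Qed.

End ZetaStep.

(** * Measurability and growth of zeta on the critical line *)

Section MeasurableZeta.
Context {R : realType}.
Implicit Types (t : R) (n m : nat) (f g : R -> R[i]).

Definition cmeasurable f : Prop :=
  measurable_fun (setT : set (measurableTypeR R)) (fun t => complex.Re (f t)) /\
  measurable_fun (setT : set (measurableTypeR R)) (fun t => complex.Im (f t)).

Lemma measurable_nsq f : cmeasurable f ->
  measurable_fun (setT : set (measurableTypeR R)) (fun t => nsq (f t)).
Proof.
by move=> [mr mi]; apply: measurable_funD; apply: measurable_funX.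
Qed.

Lemma cmeasurableD f g : cmeasurable f -> cmeasurable g ->
  cmeasurable (fun t => f t + g t).
Proof.
move=> [fr fi] [gr gi]; split.
  rewrite (_ : (fun t => _) = (fun t => complex.Re (f t) + complex.Re (g t))).
    exact: measurable_funD.
  by apply/funext => t; case: (f t) => a b; case: (g t).
rewrite (_ : (fun t => _) = (fun t => complex.Im (f t) + complex.Im (g t))).
  exact: measurable_funD.
by apply/funext => t; case: (f t) => a b; case: (g t).
Qed.

Lemma cmeasurableB f g : cmeasurable f -> cmeasurable g ->
  cmeasurable (fun t => f t - g t).
Proof.
move=> [fr fi] [gr gi]; split.
  rewrite (_ : (fun t => _) = (fun t => complex.Re (f t) - complex.Re (g t))).
    exact: measurable_funB.
  by apply/funext => t; case: (f t) => a b; case: (g t).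
rewrite (_ : (fun t => _) = (fun t => complex.Im (f t) - complex.Im (g t))).
  exact: measurable_funB.
by apply/funext => t; case: (f t) => a b; case: (g t).
Qed.

Lemma cmeasurableM f g : cmeasurable f -> cmeasurable g ->
  cmeasurable (fun t => f t * g t).
Proof.
move=> [fr fi] [gr gi]; split.
  rewrite (_ : (fun t => _) = (fun t => complex.Re (f t) * complex.Re (g t)
      - complex.Im (f t) * complex.Im (g t))).
    by apply: measurable_funB; apply: measurable_funM.
  by apply/funext => t; case: (f t) => a b; case: (g t).
rewrite (_ : (fun t => _) = (fun t => complex.Re (f t) * complex.Im (g t)
    + complex.Im (f t) * complex.Re (g t))).
  by apply: measurable_funD; apply: measurable_funM.
by apply/funext => t; case: (f t) => a b; case: (g t).
Qed.

Lemma cmeasurable_wave (c lam : R) : cmeasurable (fun t => wave c (lam * t)).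
Proof.
by split; apply: continuous_measurableW => t /=;
  apply/differentiable_continuous/derivable1_diffP; exact: ex_derive.
Qed.

Lemma cmeasurable_sum m n (F : nat -> R -> R[i]) : (forall j, cmeasurable (F j)) ->
  cmeasurable (fun t => \sum_(m <= j < n) F j t).
Proof.
move=> mF; have [nm|mn] := leqP n m.
  by under eq_fun do rewrite big_geq//; split; exact: measurable_cst.
rewrite -(subnKC (ltnW mn)); elim: (n - m)%N => [|k IH].
  by under eq_fun do rewrite addn0 big_geq//; split; exact: measurable_cst.
under eq_fun do rewrite addnS big_nat_recr ?leq_addr//=.
exact: cmeasurableD.
Qed.

Lemma zpart_wave n t :
  zpart n t = \sum_(1 <= m < n.+1) wave (rsqrt m) (ln m%:R * t).
Proof. by apply: eq_big_nat => m /andP[m1 _]; exact: cpow_wave. Qed.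

Lemma cmeasurable_zpart n : cmeasurable (zpart n).
Proof.
rewrite (_ : zpart n = (fun t => \sum_(1 <= m < n.+1) wave (rsqrt m) (ln m%:R * t))).
  by apply: cmeasurable_sum => m; exact: cmeasurable_wave.
by apply/funext => t; exact: zpart_wave.
Qed.

Lemma cmeasurable_zapprox n : (0 < n)%N -> cmeasurable (zapprox n).
Proof.
move=> n0; apply: cmeasurableB; first exact: cmeasurable_zpart.
apply: cmeasurableM.
  rewrite (_ : (fun t => _) = (fun t => wave (n%:R * rsqrt n) (ln n%:R * t))).
    exact: cmeasurable_wave.
  by apply/funext => t; exact: cpow_wave1.
have q0 t : 4^-1 + t ^+ 2 != 0 :> R by rewrite gt_eqF// ltr_wpDr ?sqr_ge0.
have E t : (1 - critical_line t)^-1 = Complex (2^-1 / (4^-1 + t ^+ 2)) (t / (4^-1 + t ^+ 2)).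
  apply: (@mulfI _ (1 - critical_line t)); first exact: onesub_neq0.
  rewrite mulfV ?onesub_neq0//; apply/eqP; rewrite eq_complex /=.
  have h : (4^-1 + t ^+ 2) * (4^-1 + t ^+ 2)^-1 = 1 by rewrite mulfV.
  by apply/andP; split; apply/eqP; lra.
have h : cmeasurable (fun t => Complex (2^-1 / (4^-1 + t ^+ 2)) (t / (4^-1 + t ^+ 2))).
  split; apply: continuous_measurableW => t /=;
  by apply/differentiable_continuous/derivable1_diffP; have := q0 t => h; exact: ex_derive.
by move: h; congr cmeasurable; apply/funext => t; rewrite E.
Qed.

Lemma cmeasurable_zeta : cmeasurable (fun t => zeta (critical_line t)).
Proof.
have small t (e : R) : 0 < e ->
    \forall n \near \oo, nsq (zeta (critical_line t) - zapprox n.+1 t) <= e ^+ 2.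
  move=> e0; have := zapprox_cvg t; rewrite -cvg_shiftS => /cvgrPdist_le /(_ (e ^+ 2)).
  rewrite exprn_gt0// => /(_ isT); apply: filterS => n /=.
  by rewrite sub0r normrN ger0_norm ?nsq_ge0.
split.
- apply: (@measurable_fun_cvg _ _ _ _ (fun n t => complex.Re (zapprox n.+1 t))).
    by move=> n; have [] := @cmeasurable_zapprox n.+1 isT.
  move=> t _; apply/cvgrPdist_le => e e0; have := small t e e0.
  apply: filterS => n /(norm_Re_le (ltW e0)).
  by case: (zeta _) => a b; case: (zapprox _ _).
- apply: (@measurable_fun_cvg _ _ _ _ (fun n t => complex.Im (zapprox n.+1 t))).
    by move=> n; have [] := @cmeasurable_zapprox n.+1 isT.
  move=> t _; apply/cvgrPdist_le => e e0; have := small t e e0.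
  apply: filterS => n /(norm_Im_le (ltW e0)).
  by case: (zeta _) => a b; case: (zapprox _ _).
Qed.

Lemma tame_zpart n : tame (fun t => nsq (zpart n t)).
Proof.
under eq_fun do rewrite zpart_wave.
exact: tame_wave_sum.
Qed.

(** The approximant at n = 1 is 1 - 1 / (1 - s), whose squared modulus is at most 2 + 2 * 4 because
    |1 - s|^2 >= 1/4; the rest is the error of [zeta_approx]. *)
Lemma nsq_zeta_le t : nsq (zeta (critical_line t)) <= 5000 * (1 + t ^+ 2).
Proof.
have -> : zeta (critical_line t) = (zeta (critical_line t) - zapprox 1 t) + zapprox 1 t by rewrite subrK.
apply: le_trans (nsqD2 _ _) _.
have h1 := zeta_approx t (isT : (0 < 1)%N); rewrite divr1 in h1.
suff : nsq (zapprox 1 t) <= 10 by have := sqr_ge0 t; lra.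
rewrite /zapprox; apply: le_trans (nsqD2 _ _) _; rewrite nsqN.
rewrite zpart_wave big_nat1 nsq_wave rsqrt_sqr invr1.
have -> : nsq (cpow 1%:R (1 - critical_line t) / (1 - critical_line t)) = (nsq (1 - critical_line t))^-1.
  rewrite nsqM cpow_wave1// nsq_wave mul1r rsqrt_sqr invr1 mul1r.
  have q0 : nsq (1 - critical_line t) != 0.
    by rewrite nsq_onesub gt_eqF// ltr_wpDr ?sqr_ge0.
  apply: (mulfI q0); rewrite -nsqM !mulfV ?onesub_neq0//.
  by rewrite /nsq /= expr0n /= addr0 expr1n.
rewrite nsq_onesub.
suff : (4^-1 + t ^+ 2)^-1 <= 4 by lra.
by rewrite -[leRHS]invrK lef_pV2 ?posrE ?invr_gt0 ?ltr_wpDr ?sqr_ge0 ?invr_gt0// lerDl sqr_ge0.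
Qed.

Lemma tame_zeta : tame (fun t => nsq (zeta (critical_line t))).
Proof.
apply: (@tame_le _ _ (fun t => 5000 * (1 + t ^+ 2))).
- by apply: measurable_nsq; exact: cmeasurable_zeta.
- by apply: tameZ; exact: tame_oneDsqr.
- by move=> t t0; rewrite ger0_norm ?nsq_ge0// nsq_zeta_le.
Qed.

Lemma tame_zeta_zpart n : tame (fun t => nsq (zeta (critical_line t) - zpart n t)).
Proof.
apply: (@tame_le _ _ (fun t => 2 * nsq (zeta (critical_line t)) + 2 * nsq (zpart n t))).
- by apply: measurable_nsq; apply: cmeasurableB; [exact: cmeasurable_zeta|exact: cmeasurable_zpart].
- by apply: tameD; apply: tameZ; [exact: tame_zeta|exact: tame_zpart].
- by move=> t t0; rewrite ger0_norm ?nsq_ge0//; apply: le_trans (nsqD2 _ _) _; rewrite nsqN.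
Qed.

End MeasurableZeta.

(** * Comparison with Dirichlet polynomials *)

Section DirichletApprox.
Context {R : realType}.
Implicit Types (D t a b : R) (n m x : nat).

Lemma waveM a b (y z : R) : wave a y * wave b z = wave (a * b) (y + z).
Proof.
by apply/eqP; rewrite eq_complex /= cosD sinD; apply/andP; split; apply/eqP; ring.
Qed.

Lemma waveB a b (y : R) : wave a y - wave b y = wave (a - b) y.
Proof. by apply/eqP; rewrite eq_complex /=; apply/andP; split; apply/eqP; ring. Qed.

(* 2 ^ (1 - s) at s = 1/2 + i t. *)
Definition twopow t : R[i] := wave (2 * rsqrt 2) (ln 2%:R * t).

Lemma rsqrtM n m : rsqrt (n * m) = rsqrt n * rsqrt m :> R.
Proof. by rewrite /rsqrt natrM sqrtrM ?ler0n// invfM. Qed.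

Lemma twopow_wave n t : (0 < n)%N ->
  twopow t * wave (rsqrt n) (ln n%:R * t) = wave (2 * rsqrt (2 * n)) (ln (2 * n)%:R * t).
Proof.
move=> n0; rewrite waveM rsqrtM natrM lnM ?posrE ?ltr0n//.
by congr wave; ring.
Qed.

Lemma nsq_twopow t : nsq (twopow t) = 2.
Proof. by rewrite nsq_wave exprMn rsqrt_sqr; field. Qed.

(** The modulus of 2^(1 - s) is sqrt 2 on the critical line, so it stays at distance at least sqrt 2
    - 1 from 1. The rational bound 13/18 for 1 / sqrt 2 is the one that yields 1/9. *)
Lemma nsq_onesub_twopow t : 1 / 9 <= nsq (1 - twopow t).
Proof.
have h : nsq (1 - twopow t) = 3 - 2 * ((2 * rsqrt 2) * cos (ln 2%:R * t)).
  have := cos2Dsin2 (ln (2%:R : R) * t); have := @rsqrt_sqr R 2.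
  rewrite /nsq /=; set r := rsqrt 2; set c := cos _; set d := sin _ => hr hcd.
  have -> : (1 - 2 * r * c) ^+ 2 + (0 - - (2 * r * d)) ^+ 2
    = 1 - 4 * (r * c) + 4 * r ^+ 2 * (c ^+ 2 + d ^+ 2) by ring.
  by rewrite hcd hr; field.
rewrite h.
have r0 : 0 <= rsqrt 2 :> R by rewrite ltW// rsqrt_gt0.
have hc : (2 * rsqrt 2) * cos (ln 2%:R * t) <= 2 * rsqrt 2.
  by rewrite ler_piMr ?mulr_ge0// cos_le1.
have : rsqrt 2 <= 13 / 18 :> R.
  rewrite -(ler_pXn2r (_ : (0 < 2)%N)) ?nnegrE// rsqrt_sqr; lra.
lra.
Qed.

(** The first 2 n terms of the alternating series: subtracting 2 * 2^-s times the sum up to n flips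
    the sign of the even terms. *)
Definition zeta_alt n t : R[i] := zpart (2 * n) t - twopow t * zpart n t.

(** The pole terms cancel because (2 n)^(1 - s) = 2^(1 - s) n^(1 - s). *)
Lemma zeta_alt_zapprox n t : (0 < n)%N ->
  zeta_alt n t = zapprox (2 * n) t - twopow t * zapprox n t.
Proof.
move=> n0; have n20 : (0 < 2 * n)%N by rewrite muln_gt0.
rewrite /zapprox.
have -> : cpow (2 * n)%:R (1 - critical_line t) = twopow t * cpow n%:R (1 - critical_line t).
  rewrite !cpow_wave1// waveM natrM rsqrtM lnM ?posrE ?ltr0n//.
  by congr wave; ring.
by rewrite /zeta_alt; ring.
Qed.

Lemma zpartS n t :
  zpart n.+1 t = zpart n t + wave (rsqrt n.+1) (ln n.+1%:R * t).
Proof. by rewrite !zpart_wave big_nat_recr. Qed.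

Lemma zeta_alt_diff x n t : (x <= n)%N ->
  zeta_alt n t - zeta_alt x t =
  \sum_(x <= j < n) (wave (rsqrt (2 * j).+1) (ln (2 * j).+1%:R * t)
                   - wave (rsqrt (2 * j).+2) (ln (2 * j).+2%:R * t)).
Proof.
move=> xn; apply: esym; apply: (@telescope_sumr_eq _ _ _ (fun j => zeta_alt j t)) => // j _.
rewrite /zeta_alt mulnSr addn2 !zpartS mulrDr twopow_wave// mulnSr addn2.
have -> : wave (2 * rsqrt (2 * j).+2) (ln (2 * j).+2%:R * t) =
  wave (rsqrt (2 * j).+2) (ln (2 * j).+2%:R * t) + wave (rsqrt (2 * j).+2) (ln (2 * j).+2%:R * t).
  by apply/eqP; rewrite eq_complex /=; apply/andP; split; apply/eqP; ring.
by ring.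
Qed.

(** The identity is exact for every n > 0, so n can be taken much larger than x. The last block
    appears because [zeta_alt x] reaches 2 x while the polynomial stops at x. *)
Lemma zeta_zpart_decomp x n t : (0 < n)%N ->
  (1 - twopow t) * (zeta (critical_line t) - zpart x t) =
  ((zeta (critical_line t) - zapprox (2 * n) t) - twopow t * (zeta (critical_line t) - zapprox n t))
  + (zeta_alt n t - zeta_alt x t) + (zpart (2 * x) t - zpart x t).
Proof. by move=> n0; rewrite zeta_alt_zapprox// /zeta_alt; ring. Qed.

Lemma ln_step_le n m : (0 < n)%N -> (n <= m)%N ->
  ln m%:R - ln n%:R <= (m - n)%:R / n%:R :> R.
Proof.
move=> n0 nm; have n1 : (0 : R) < n%:R by rewrite ltr0n.
have m1 : (0 : R) < m%:R by rewrite ltr0n (leq_trans n0).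
rewrite -ln_div ?posrE// (_ : m%:R / n%:R = 1 + (m - n)%:R / n%:R).
  by rewrite le_ln1Dx// (lt_le_trans (ltrN10 _))// divr_ge0.
by rewrite natrB// mulrBl divff ?gt_eqF// addrC subrK.
Qed.

Lemma ln_step_ge n m : (0 < n)%N -> (n <= m)%N ->
  (m - n)%:R / m%:R <= ln m%:R - ln n%:R :> R.
Proof.
move=> n0 nm; have n1 : (0 : R) < n%:R by rewrite ltr0n.
have m1 : (0 : R) < m%:R by rewrite ltr0n (leq_trans n0).
rewrite -[leRHS]opprB -ln_div ?posrE// -[leLHS]opprK lerN2.
rewrite (_ : n%:R / m%:R = 1 + - ((m - n)%:R / m%:R)).
  rewrite le_ln1Dx// ltrN2 ltr_pdivrMr// mul1r ltr_nat; lia.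
by rewrite natrB// mulrBl divff ?gt_eqF//; ring.
Qed.

Lemma rsqrt_diff_sqr n : (0 < n)%N ->
  (rsqrt n - rsqrt n.+1 : R) ^+ 2 <= n%:R ^- 3.
Proof.
move=> n0; rewrite rsqrtB//.
set p := Num.sqrt n%:R; set q := Num.sqrt n.+1%:R.
have p0 : 0 < p by rewrite sqrtr_gt0 ltr0n.
have q0 : 0 < q by rewrite sqrtr_gt0 ltr0n.
have p2 : p ^+ 2 = n%:R by rewrite sqr_sqrtr.
have q2 : q ^+ 2 = p ^+ 2 + 1 by rewrite p2 sqr_sqrtr// natr1.
have pq : p <= q by rewrite -(ler_pXn2r (_ : (0 < 2)%N)) ?nnegrE ?ltW// q2 ltrDl.
rewrite -p2 exprVn lef_pV2 ?posrE ?exprn_gt0 ?mulr_gt0 ?addr_gt0//.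
have -> : (p ^+ 2) ^+ 3 = (p ^+ 3) ^+ 2 by ring.
rewrite ler_sqr ?nnegrE ?exprn_ge0 ?mulr_ge0 ?addr_ge0 ?ltW//.
have -> : p ^+ 3 = p * p * p by ring.
nra.
Qed.

Lemma sum_invsqr_le x n : (0 < x)%N ->
  \sum_(x <= j < n) (j%:R ^- 2 : R) <= 2 / x%:R.
Proof.
move=> x0; have [nx|xn] := leqP n x; first by rewrite big_geq// divr_ge0.
apply: (@le_trans _ _ (\sum_(x <= j < n) (- (2 / j.+1%:R) - - (2 / j%:R)))).
  apply: ler_sum_nat => j /andP[xj _].
  have j0 : (0 : R) < j%:R by rewrite ltr0n (leq_trans x0).
  have j1 : (1 : R) <= j%:R by rewrite ler1n (leq_trans x0).
  rewrite -[j.+1%:R]natr1.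
  have -> : - (2 / (j%:R + 1)) - - (2 / j%:R) = 2 / (j%:R * (j%:R + 1)) :> R.
    by field; rewrite !gt_eqF// addr_gt0.
  rewrite -[2]invrK -invfM lef_pV2 ?posrE ?exprn_gt0 ?mulr_gt0 ?invr_gt0 ?addr_gt0//.
  rewrite ler_pdivrMl//; nra.
rewrite telescope_sumr 1?ltnW//.
have : 0 <= 2 / n%:R :> R by rewrite divr_ge0.
lra.
Qed.

End DirichletApprox.

(** * Mean square of zeta minus its Dirichlet polynomial *)

Section ZetaMeanSquareError.
Context {R : realType}.
Implicit Types (D t : R) (n m x : nat).

(** Frequencies of the odd and the even member of the j-th pair of the alternating series. *)
Let lam j : R := ln (2 * j).+1%:R.
Let mu j : R := ln (2 * j).+2%:R.

Let natD_le1 D x m : 1 <= D * x%:R -> (0 < x)%N -> (x <= m)%N -> m%:R^-1 <= D.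
Proof.
move=> xD x0 xm; have m0 : (0 : R) < m%:R by rewrite ltr0n (leq_trans x0).
rewrite -[m%:R^-1]mul1r ler_pdivrMr//.
have D0 : 0 <= D by rewrite -(@pmulr_lge0 _ x%:R) ?ltr0n// (le_trans _ xD).
by apply: le_trans xD _; rewrite ler_wpM2l// ler_nat.
Qed.

Let lam_step D x : 1 <= D * x%:R -> (0 < x)%N ->
  forall j, (x <= j)%N -> 0 < lam j.+1 - lam j <= D.
Proof.
move=> xD x0 j xj; have j0 := leq_trans x0 xj.
have e : (((2 * j.+1).+1 - (2 * j).+1) = 2)%N by lia.
have le : ((2 * j).+1 <= (2 * j.+1).+1)%N by lia.
apply/andP; split.
  apply: lt_le_trans (ln_step_ge (ltn0Sn _) le).
  by rewrite e divr_gt0.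
apply: le_trans (ln_step_le (ltn0Sn _) le) _; rewrite e.
apply: le_trans (natD_le1 xD x0 xj).
have j1 : (0 : R) < j%:R by rewrite ltr0n.
rewrite ler_pdivrMr ?ltr0n// ler_pdivlMl// -!natrM ler_nat; lia.
Qed.

Let lam_step_ge j : (0 < j)%N -> (lam j.+1 - lam j)^-1 <= 5 / 2 * j%:R.
Proof.
move=> j0.
have e : (((2 * j.+1).+1 - (2 * j).+1) = 2)%N by lia.
have le : ((2 * j).+1 <= (2 * j.+1).+1)%N by lia.
have := @ln_step_ge R _ _ (ltn0Sn _) le; rewrite e => h.
have h0 : (0 : R) < 2 / (2 * j.+1).+1%:R by rewrite divr_gt0.
have h1 := lt_le_trans h0 h.
have h2 : (0 : R) < (5 / 2 * j%:R)^-1 by rewrite invr_gt0 mulr_gt0// ltr0n.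
rewrite -[leRHS]invrK lef_pV2 ?posrE//.
have jR : (0 : R) < j%:R by rewrite ltr0n.
apply: le_trans h; rewrite ler_pdivlMr ?ltr0n// ler_pdivrMl ?mulr_gt0//.
have : (2 * j.+1).+1%:R <= 5%:R * j%:R :> R by rewrite -natrM ler_nat; lia.
lra.
Qed.

Let mu_step D x : 1 <= D * x%:R -> (0 < x)%N ->
  forall j, (x <= j)%N -> 0 <= mu j - lam j <= D.
Proof.
move=> xD x0 j xj; have j0 := leq_trans x0 xj.
apply/andP; split; first by rewrite subr_ge0 ler_ln ?posrE ?ltr0n// ler_nat.
apply: le_trans (ln_step_le (ltn0Sn _) (leqnSn _)) _; rewrite subSnn.
apply: le_trans (natD_le1 xD x0 xj).
rewrite mul1r lef_pV2 ?posrE ?ltr0n// ler_nat; lia.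
Qed.

Let mu_lam_le j : (0 < j)%N -> 0 <= mu j - lam j <= (2 * j%:R)^-1.
Proof.
move=> j0.
apply/andP; split; first by rewrite subr_ge0 ler_ln ?posrE ?ltr0n// ler_nat.
apply: le_trans (ln_step_le (ltn0Sn _) (leqnSn _)) _; rewrite subSnn.
by rewrite mul1r lef_pV2 ?posrE ?mulr_gt0 ?ltr0n// -natrM ler_nat.
Qed.

(** A pair splits into a change of amplitude at fixed frequency and a change of phase at fixed
    amplitude; this is the former. Squared coefficients of order j^-3 over gaps of order 1 / j leave
    a tail of the sum of j^-2, at most 2 / x <= 2 D. *)
Lemma laplace_alt_amplitude D x n : 0 < D -> (0 < x)%N -> 1 <= D * x%:R ->
  laplace D (fun t => nsq (\sum_(x <= j < n) wave (rsqrt (2 * j).+1 - rsqrt (2 * j).+2) (lam j * t)))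
  <= 15 * pi * D.
Proof.
move=> D0 x0 xD.
apply: le_trans (laplace_wave_sum_le n _ D0 (lam_step xD x0)) _.
have p0 : 0 < pi :> R := pi_gt0 R.
have -> : 15 * pi * D = 3 * pi * (5 * D) by ring.
rewrite ler_wpM2l ?mulr_ge0 ?(ltW p0)//.
apply: (@le_trans _ _ (\sum_(x <= j < n) 5 / 2 * j%:R ^- 2)).
  apply: ler_sum_nat => j /andP[xj _]; have j0 := leq_trans x0 xj.
  have jR : (0 : R) < j%:R by rewrite ltr0n.
  apply: (@le_trans _ _ (j%:R ^- 3 * (5 / 2 * j%:R))).
    apply: ler_pM; rewrite ?sqr_ge0//.
    - by rewrite invr_ge0 ltW//; have /andP[] := lam_step xD x0 xj.
    - apply: le_trans (rsqrt_diff_sqr (ltn0Sn _)) _.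
      rewrite lef_pV2 ?posrE ?exprn_gt0 ?ltr0n// lerXn2r ?nnegrE// ler_nat; lia.
    - exact: lam_step_ge.
  by rewrite le_eqVlt; apply/orP; left; apply/eqP; field; rewrite gt_eqF.
rewrite -mulr_sumr; have := @sum_invsqr_le R x n x0; have := natD_le1 xD x0 (leqnn x).
lra.
Qed.

(** Squared coefficient 1 / j, squared shift 1 / j^2 and inverse gap j again give a tail of the sum
    of j^-2, hence O(D); the factor 18 / D^2 from the second differences turns it into O(1 / D). *)
Lemma laplace_alt_phase D x n : 0 < D -> (0 < x)%N -> 1 <= D * x%:R ->
  laplace D (fun t => nsq (\sum_(x <= j < n)
      (wave (rsqrt (2 * j).+2) (lam j * t) - wave (rsqrt (2 * j).+2) (mu j * t))))
  <= 108 * pi / D.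
Proof.
move=> D0 x0 xD.
apply: le_trans (laplace_wave_diff_sum_le n _ D0 (lam_step xD x0) (mu_step xD x0)) _.
have p0 : 0 < pi :> R := pi_gt0 R.
have -> : 108 * pi / D = 18 / D ^+ 2 * (3 * pi * (2 * D)) by field; rewrite gt_eqF.
rewrite ler_wpM2l ?divr_ge0 ?exprn_ge0 ?(ltW D0)//.
rewrite ler_wpM2l ?mulr_ge0 ?(ltW p0)//.
apply: (@le_trans _ _ (\sum_(x <= j < n) j%:R ^- 2)); last first.
  by have := @sum_invsqr_le R x n x0; have := natD_le1 xD x0 (leqnn x); lra.
apply: ler_sum_nat => j /andP[xj _]; have j0 := leq_trans x0 xj.
have jR : (0 : R) < j%:R by rewrite ltr0n.
have /andP[g0 g1] := mu_lam_le j0.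
apply: (@le_trans _ _ (j%:R^-1 * (2 * j%:R) ^- 2 * (5 / 2 * j%:R))).
  apply: ler_pM; rewrite ?sqr_ge0//.
  - by rewrite invr_ge0 ltW//; have /andP[] := lam_step xD x0 xj.
  - rewrite exprMn; apply: ler_pM; rewrite ?sqr_ge0//.
      rewrite rsqrt_sqr lef_pV2 ?posrE ?ltr0n// ler_nat; lia.
    by rewrite -exprVn ler_sqr ?nnegrE ?invr_ge0 ?mulr_ge0.
  - exact: lam_step_ge.
have -> : j%:R^-1 * (2 * j%:R) ^- 2 * (5 / 2 * j%:R) = 5 / 8 * j%:R ^- 2 :> R.
  by field; rewrite gt_eqF.
by rewrite ler_piMl ?invr_ge0 ?exprn_ge0//; lra.
Qed.

(** In this block the squared coefficient 1 / k and the gap, about 1 / k, balance: each of the x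
    terms contributes at most 2, and x <= 2 / D. *)
Lemma laplace_zpart_diff D x : 0 < D -> (0 < x)%N -> 1 <= D * x%:R -> D * x%:R <= 2 ->
  laplace D (fun t => nsq (zpart (2 * x) t - zpart x t)) <= 12 * pi / D.
Proof.
move=> D0 x0 xD Dx.
have p0 : 0 < pi :> R := pi_gt0 R.
have -> : (fun t => nsq (zpart (2 * x) t - zpart x t)) =
   (fun t => nsq (\sum_(x.+1 <= m < (2 * x).+1) wave (rsqrt m) ((fun m => ln m%:R : R) m * t))).
  apply/funext => t; congr nsq; rewrite !zpart_wave.
  rewrite (@big_cat_nat _ _ _ x.+1)//=; last by rewrite ltnS leq_pmull.
  by ring.
have st k : (x.+1 <= k)%N -> 0 < (ln k.+1%:R - ln k%:R : R) <= D.
  move=> xk; have k0 : (0 < k)%N by exact: leq_trans xk.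
  apply/andP; split; first by rewrite subr_gt0 ltr_ln ?posrE ?ltr0n// ltr_nat.
  apply: le_trans (ln_step_le k0 (leqnSn _)) _; rewrite subSnn mul1r.
  by apply: (natD_le1 xD) => //; exact: ltnW.
apply: le_trans (@laplace_wave_sum_le R D x.+1 (2 * x).+1 (@rsqrt R) (fun m => ln m%:R) D0 st) _.
have -> : 12 * pi / D = 3 * pi * (4 / D) by ring.
rewrite ler_wpM2l ?mulr_ge0 ?(ltW p0)//.
apply: (@le_trans _ _ (\sum_(x.+1 <= m < (2 * x).+1) 2)).
  apply: ler_sum_nat => k /andP[xk _]; have k0 : (0 < k)%N by exact: leq_trans xk.
  have kR : (0 : R) < k%:R by rewrite ltr0n.
  have := @ln_step_ge R _ _ k0 (leqnSn _); rewrite subSnn div1r => h.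
  have h0 : 0 < ln k.+1%:R - ln k%:R :> R by have /andP[] := st _ xk.
  rewrite rsqrt_sqr ler_pdivrMr// -[leLHS]mul1r ler_pdivrMr//.
  apply: (@le_trans _ _ (2 * k.+1%:R^-1 * k%:R)); last by rewrite ler_pM2r// ler_pM2l.
  rewrite mulrAC ler_pdivlMr ?ltr0n// mul1r -natrM ler_nat; lia.
rewrite sumr_const_nat (_ : ((2 * x).+1 - x.+1 = x)%N); last by lia.
rewrite ler_pdivlMr// -mulr_natr; lra.
Qed.

Lemma laplace_zeta_zpart : exists K : R, 0 <= K /\ forall D x,
  0 < D <= 1 -> (0 < x)%N -> 1 <= D * x%:R -> D * x%:R <= 2 ->
  laplace D (fun t => nsq (zeta (critical_line t) - zpart x t)) <= K / D.
Proof.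
have p0 : 0 < pi :> R := pi_gt0 R.
(* The 5 is 2 * 1/2 + 2 * 2: the remainder at 2 M is half the one at M, and the latter carries the
   weight |2^(1 - s)|^2 = 2. *)
have [C1 [C10 C1E]] : exists C1 : R, 0 <= C1 /\ C1 = 5 * 2048.
  by exists (5 * 2048); split; [rewrite mulr_ge0 ?ler0n|reflexivity].
exists (36 * (C1 * 18) + 72 * (15 * pi) + 72 * (108 * pi) + 18 * (12 * pi)).
split; first by lra.
move=> D x /andP[D0 D1] x0 xD Dx.
(* The transform of (1 + t^2) / M is O(1 / (M D^3)), and 1 / M <= D^2 makes it O(1 / D). *)
pose M := (x * x)%N.
have M0 : (0 < M)%N by rewrite muln_gt0 x0.
have xM : (x <= M)%N by rewrite leq_pmulr.
have MR : (0 : R) < M%:R by rewrite ltr0n.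
pose f2 t := \sum_(x <= j < M) wave (rsqrt (2 * j).+1 - rsqrt (2 * j).+2) (lam j * t).
pose f3 t := \sum_(x <= j < M)
      (wave (rsqrt (2 * j).+2) (lam j * t) - wave (rsqrt (2 * j).+2) (mu j * t)).
pose f4 t := zpart (2 * x) t - zpart x t.
have t2 : tame (fun t => nsq (f2 t)) by exact: tame_wave_sum.
have t3 : tame (fun t => nsq (f3 t)) by exact: tame_wave_diff_sum.
have t4 : tame (fun t => nsq (f4 t)).
  apply: (@tame_le _ _ (fun t => 2 * nsq (zpart (2 * x) t) + 2 * nsq (zpart x t))).
  - by apply: measurable_nsq; apply: cmeasurableB; exact: cmeasurable_zpart.
  - by apply: tameD; apply: tameZ; exact: tame_zpart.
  - by move=> t t0; rewrite ger0_norm ?nsq_ge0//; apply: le_trans (nsqD2 _ _) _; rewrite nsqN.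
(* These are 9 times 4, 8, 8 and 2: the weights come from repeated use of [nsqD2], the 9 from the
   lower bound on |1 - 2^(1 - s)|^2. *)
pose g t := 36 * (C1 / M%:R * (1 + t ^+ 2)) + 72 * nsq (f2 t) + 72 * nsq (f3 t) + 18 * nsq (f4 t).
have tg : tame g.
  by do ![exact: tame_oneDsqr|assumption|apply: tameD|apply: tameZ].
have le_g t : nsq (zeta (critical_line t) - zpart x t) <= g t.
  have h1 := nsq_onesub_twopow t.
  set E := _ - _.
  have q0 := nsq_ge0 E.
  suff : nsq ((1 - twopow t) * E) <= 9^-1 * g t.
    rewrite nsqM => h.
    have : 1 / 9 * nsq E <= nsq (1 - twopow t) * nsq E by rewrite ler_wpM2r.
    lra.
  rewrite (zeta_zpart_decomp x t M0) zeta_alt_diff//.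
  set f1 := _ - twopow t * _.
  have -> : \sum_(x <= j < M) (wave (rsqrt (2 * j).+1) (ln (2 * j).+1%:R * t)
                   - wave (rsqrt (2 * j).+2) (ln (2 * j).+2%:R * t)) = f2 t + f3 t.
    rewrite /f2 /f3 -big_split /=; apply: eq_bigr => j _.
    by rewrite -waveB addrA subrK.
  rewrite -/(f4 t).
  have h4 := nsqD2 (f1 + (f2 t + f3 t)) (f4 t).
  have h23 := nsqD2 (f2 t) (f3 t).
  have h123 := nsqD2 f1 (f2 t + f3 t).
  suff : nsq f1 <= C1 / M%:R * (1 + t ^+ 2) by rewrite /g; lra.
  rewrite /f1; apply: le_trans (nsqD2 _ _) _.
  rewrite nsqN nsqM nsq_twopow.
  have M20 : (0 < 2 * M)%N by rewrite muln_gt0.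
  have hA := zeta_approx t M20; have hB := zeta_approx t M0.
  have eA : 2048 * (1 + t ^+ 2) / (2 * M)%:R = 2^-1 * (2048 * (1 + t ^+ 2) / M%:R) :> R.
    by rewrite natrM invfM; ring.
  have -> : C1 / M%:R * (1 + t ^+ 2) = 5 * (2048 * (1 + t ^+ 2) / M%:R) by rewrite C1E; ring.
  rewrite eA in hA; move: hA hB; move: (2048 * (1 + t ^+ 2) / M%:R) => z hA hB; lra.
apply: (@le_trans _ _ (laplace D g)).
  by apply: le_laplace => //; exact: tame_zeta_zpart.
rewrite /g.
do 3 (rewrite laplaceD//; try by do ![exact: tame_oneDsqr|assumption|apply: tameD|apply: tameZ]).
do 5 (rewrite laplaceZ//; try by do ![exact: tame_oneDsqr|assumption|apply: tameD|apply: tameZ]).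
have h2 : laplace D (fun t => nsq (f2 t)) <= 15 * pi * D := laplace_alt_amplitude M D0 x0 xD.
have h3 : laplace D (fun t => nsq (f3 t)) <= 108 * pi / D := laplace_alt_phase M D0 x0 xD.
have h4 : laplace D (fun t => nsq (f4 t)) <= 12 * pi / D := laplace_zpart_diff D0 x0 xD Dx.
have h1 := laplace_oneDsqr (introT andP (conj D0 D1)).
have hM : M%:R^-1 <= D ^+ 2.
  rewrite /M natrM invfM expr2.
  have := natD_le1 xD x0 (leqnn x) => h.
  by apply: ler_pM; rewrite ?invr_ge0.
have h1' : C1 / M%:R * laplace D (fun t => 1 + t ^+ 2) <= C1 * 18 / D.
  apply: (@le_trans _ _ (C1 * D ^+ 2 * (18 / D ^+ 3))).
    apply: ler_pM => //; first by rewrite divr_ge0.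
      by apply: laplace_ge0 => t t0; rewrite addr_ge0 ?sqr_ge0.
    by rewrite ler_wpM2l.
  by rewrite le_eqVlt; apply/orP; left; apply/eqP; field; rewrite gt_eqF.
have h2' : 15 * pi * D <= 15 * pi / D.
  rewrite ler_pM2l ?mulr_gt0//.
  by apply: (le_trans D1); rewrite -invr1 lef_pV2 ?posrE.
have -> : (36 * (C1 * 18) + 72 * (15 * pi) + 72 * (108 * pi) + 18 * (12 * pi)) / D =
  36 * (C1 * 18 / D) + 72 * (15 * pi / D) + 72 * (108 * pi / D) + 18 * (12 * pi / D) by ring.
by rewrite !lerD// ler_wpM2l//; apply: le_trans h2'.
Qed.

End ZetaMeanSquareError.

(** * The Laplace transform of |zeta|^2 *)

Section DirichletMeanSquare.
Context {R : realType}.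
Implicit Types (D t e u : R) (n m x i j : nat).

(** Off the diagonal the kernel is bounded by D / xi^2, and ln j - ln i >= (j - i) / j. *)
Lemma kern_ln_le D i j : 0 < D -> (0 < i)%N -> (i < j)%N ->
  kern D (ln i%:R - ln j%:R) <= D * (j%:R ^+ 2 / (j - i)%:R ^+ 2).
Proof.
move=> D0 i0 ij; have j0 : (0 < j)%N by apply: leq_trans ij.
have d0 : (0 : R) < (j - i)%:R by rewrite ltr0n subn_gt0.
have jR : (0 : R) < j%:R by rewrite ltr0n.
rewrite -kernN opprB /kern ler_pM2l// -invf_div lef_pV2 ?posrE ?divr_gt0 ?exprn_gt0 ?kern_den_gt0//.
have h := @ln_step_ge R _ _ i0 (ltnW ij).
rewrite -expr_div_n; apply: (@le_trans _ _ ((ln j%:R - ln i%:R) ^+ 2)).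
  have q0 : 0 <= (j - i)%:R / j%:R :> R by rewrite divr_ge0.
  by rewrite ler_sqr ?nnegrE//; exact: le_trans q0 h.
by rewrite lerDr sqr_ge0.
Qed.

Lemma sum_invsqr1 n : \sum_(1 <= d < n) (d%:R ^- 2 : R) <= 2.
Proof. by have := @sum_invsqr_le R 1 n isT; rewrite divr1. Qed.

(** Below the diagonal the terms are D i^2 / (i - j)^2. Above it, j^2 <= 2 i^2 + 2 (j - i)^2 splits
    them into a convergent part and a constant 2 D, counted at most x times. *)
Lemma kern_ln_row D x i : 0 < D -> (1 <= i < x.+1)%N ->
  \sum_(1 <= j < x.+1) (if i == j then 0 else kern D (ln i%:R - ln j%:R))
  <= D * (8 * i%:R ^+ 2 + 2 * x%:R).
Proof.
move=> D0 /andP[i1 ix].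
have iR : (0 : R) < i%:R by rewrite ltr0n.
rewrite (@big_cat_nat _ _ _ i)//=; last by rewrite ltnW.
rewrite [X in _ + X]big_ltn// eqxx add0r.
have h1 : \sum_(1 <= j < i) (if i == j then 0 else kern D (ln i%:R - ln j%:R))
    <= D * (2 * i%:R ^+ 2).
  apply: (@le_trans _ _ (\sum_(1 <= j < i) D * i%:R ^+ 2 * (i - j)%:R ^- 2)).
    apply: ler_sum_nat => j /andP[j1 ji]; rewrite gtn_eqF//.
    rewrite -kernN opprB -mulrA; exact: kern_ln_le.
  rewrite -mulr_sumr (_ : D * (2 * _) = D * i%:R ^+ 2 * 2); last by ring.
  rewrite ler_wpM2l ?mulr_ge0 ?(ltW D0) ?exprn_ge0//.
  rewrite big_nat_rev/=; apply: le_trans (sum_invsqr1 i).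
  rewrite le_eqVlt; apply/orP; left; apply/eqP; apply: eq_big_nat => j /andP[j1 ji].
  by congr ((_ %:R) ^- 2); lia.
have h2 : \sum_(i.+1 <= j < x.+1) (if i == j then 0 else kern D (ln i%:R - ln j%:R))
    <= D * (4 * i%:R ^+ 2 + 2 * x%:R).
  apply: (@le_trans _ _ (\sum_(i.+1 <= j < x.+1) D * (2 * i%:R ^+ 2 * (j - i)%:R ^- 2 + 2))).
    apply: ler_sum_nat => j /andP[ij _]; rewrite ltn_eqF//.
    apply: le_trans (kern_ln_le D0 i1 ij) _; rewrite ler_pM2l//.
    have d0 : (0 : R) < (j - i)%:R by rewrite ltr0n subn_gt0.
    rewrite ler_pdivrMr ?exprn_gt0//.
    have -> : (2 * i%:R ^+ 2 * (j - i)%:R ^- 2 + 2) * (j - i)%:R ^+ 2 =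
      2 * i%:R ^+ 2 + 2 * (j - i)%:R ^+ 2 :> R by field; rewrite gt_eqF.
    have -> : j%:R = i%:R + (j - i)%:R :> R by rewrite -natrD subnKC// ltnW.
    have := sqr_ge0 (i%:R - (j - i)%:R : R); lra.
  rewrite -mulr_sumr ler_wpM2l ?(ltW D0)// big_split /=; apply: lerD.
    rewrite -mulr_sumr.
    have -> : 4 * i%:R ^+ 2 = 2 * i%:R ^+ 2 * 2 :> R by ring.
    rewrite ler_wpM2l ?mulr_ge0 ?exprn_ge0//.
    rewrite -add1n big_addn; apply: le_trans (sum_invsqr1 (x.+1 - i)).
    rewrite le_eqVlt; apply/orP; left; apply/eqP; apply: eq_big_nat => j _.
    by rewrite addnK.
  rewrite sumr_const_nat -[leLHS]mulr_natr ler_pM2l// ler_nat; lia.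
apply: le_trans (lerD h1 h2) _; rewrite -mulrDr ler_pM2l//.
have := sqr_ge0 (i%:R : R); lra.
Qed.

Definition harmonic_sum x : R := \sum_(1 <= j < x.+1) j%:R^-1.

(** The diagonal gives the harmonic sum over D. Small integers have logarithmic gaps larger than D,
    so the gap weights are out of reach and Schur's test is run with weight 1: a row bound D (8 i^2
    + 2 x) against the squared coefficient 1 / i is at most 10 D x. *)
Lemma laplace_zpart D x : 0 < D ->
  `|laplace D (fun t => nsq (zpart x t)) - harmonic_sum x / D| <= 10 * (D * x%:R ^+ 2).
Proof.
move=> D0.
have -> : (fun t => nsq (zpart x t)) =
   (fun t => nsq (\sum_(1 <= m < x.+1) wave (rsqrt m) ((fun m => ln m%:R : R) m * t))).
  by apply/funext => t; rewrite zpart_wave.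
rewrite (@laplace_wave_sum R D 1 x.+1 (@rsqrt R) (fun m => ln m%:R) D0).
pose K i j : R := if i == j then 0 else kern D (ln i%:R - ln j%:R).
have -> : \sum_(1 <= i < x.+1) \sum_(1 <= j < x.+1) rsqrt i * rsqrt j * kern D (ln i%:R - ln j%:R)
  = \sum_(1 <= i < x.+1) \sum_(1 <= j < x.+1) rsqrt i * rsqrt j * K i j + harmonic_sum x / D.
  rewrite /harmonic_sum mulr_suml -big_split /=; apply: eq_big_nat => i /andP[i1 ix].
  have E (F : nat -> R) : \sum_(1 <= j < x.+1) F j =
      \sum_(1 <= j < i) F j + F i + \sum_(i.+1 <= j < x.+1) F j.
    by rewrite (@big_cat_nat _ _ _ i)//= ?(ltnW ix)// [X in _ + X]big_ltn// addrA.
  rewrite !E {2}/K eqxx mulr0 addr0 subrr /kern expr0n /= addr0.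
  have -> : \sum_(1 <= j < i) rsqrt i * rsqrt j * K i j =
     \sum_(1 <= j < i) rsqrt i * rsqrt j * (D / (D ^+ 2 + (ln i%:R - ln j%:R) ^+ 2)).
    by apply: eq_big_nat => j /andP[_ ji]; rewrite /K gtn_eqF.
  have -> : \sum_(i.+1 <= j < x.+1) rsqrt i * rsqrt j * K i j =
     \sum_(i.+1 <= j < x.+1) rsqrt i * rsqrt j * (D / (D ^+ 2 + (ln i%:R - ln j%:R) ^+ 2)).
    by apply: eq_big_nat => j /andP[ij _]; rewrite /K ltn_eqF.
  rewrite -expr2 rsqrt_sqr (_ : D / D ^+ 2 = D^-1); first by ring.
  by field; rewrite gt_eqF.
rewrite addrK.
have K0 i j : 0 <= K i j by rewrite /K; case: ifP => // _; rewrite ltW// kern_gt0.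
apply: (@le_trans _ _ (\sum_(1 <= i < x.+1) \sum_(1 <= j < x.+1) `|rsqrt i : R| * `|rsqrt j| * K i j)).
  apply: le_trans (ler_norm_sum _ _ _) _; apply: ler_sum => i _.
  apply: le_trans (ler_norm_sum _ _ _) _; apply: ler_sum => j _.
  by rewrite !normrM (ger0_norm (K0 _ _)).
apply: le_trans (@schur_test R K (@rsqrt R) (fun=> 1)
   (fun i => D * (8 * i%:R ^+ 2 + 2 * x%:R)) 1 x.+1 _ _ _ _) _.
- move=> i j _ _; rewrite /K eq_sym; case: ifP => // _.
  by rewrite -kernN opprB.
- by [].
- by [].
- move=> i ix; under eq_bigr do rewrite mul1r; exact: kern_ln_row.
apply: (@le_trans _ _ (\sum_(1 <= i < x.+1) D * (10 * x%:R))).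
  apply: ler_sum_nat => i /andP[i1 ix].
  have iR : (1 : R) <= i%:R by rewrite ler1n.
  have ixR : (i%:R : R) <= x%:R by rewrite ler_nat.
  have i0 : (0 : R) < i%:R by rewrite ltr0n.
  rewrite rsqrt_sqr divr1 mulrCA ler_pM2l// ler_pdivrMl//.
  nra.
rewrite sumr_const_nat subn1 /= -[leLHS]mulr_natr.
by rewrite le_eqVlt; apply/orP; left; apply/eqP; ring.
Qed.

Lemma harmonic_sum_bounds x : (0 < x)%N ->
  ln x%:R <= harmonic_sum x <= 1 + ln x%:R.
Proof.
move=> x0; apply/andP; split.
  apply: (@le_trans _ _ (ln x.+1%:R)).
    by rewrite ler_ln ?posrE ?ltr0n// ler_nat.
  apply: (@le_trans _ _ (\sum_(1 <= j < x.+1) (ln j.+1%:R - ln j%:R))).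
    by rewrite telescope_sumr// ln1 subr0.
  apply: ler_sum_nat => j /andP[j1 _].
  by have := @ln_step_le R _ _ j1 (leqnSn j); rewrite subSnn mul1r.
rewrite /harmonic_sum big_ltn// invr1 lerD2l.
apply: (@le_trans _ _ (\sum_(1 <= j < x) (ln j.+1%:R - ln j%:R))); last first.
  by rewrite telescope_sumr// ln1 subr0.
rewrite big_add1 /=; apply: ler_sum_nat => j /andP[j1 _].
by have := @ln_step_ge R _ _ j1 (leqnSn j); rewrite subSnn mul1r.
Qed.

Lemma exists_cutoff D : 0 < D <= 1 ->
  exists x, [/\ (0 < x)%N, 1 <= D * x%:R & D * x%:R <= 2].
Proof.
move=> /andP[D0 D1].
have Di : 1 <= D^-1 by rewrite -invr1 lef_pV2 ?posrE.
exists (Num.truncn D^-1).+1; split=> //.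
- rewrite -ler_pdivrMl// mulr1; apply: ltW; exact: truncnS_gt.
- rewrite -ler_pdivlMl// -natr1.
  have : (Num.truncn D^-1)%:R <= D^-1 by rewrite truncn_le// (le_trans ler01).
  lra.
Qed.

Definition zeta_laplace D : R := laplace D (fun t => nsq (zeta (critical_line t))).

(** Applied to zeta = S + E and to S = zeta - E, [nsqD_le] gives both directions. The parameter e
    stays free: the limit needs a leading coefficient arbitrarily close to 1, and K / e is
    negligible against ln (1 / D) for fixed e. *)
Lemma zeta_laplace_cmp : exists K : R, 0 <= K /\ forall D e, 0 < D <= 1 -> 0 < e <= 1 ->
  D * zeta_laplace D <= (1 + e) * ln D^-1 + K / e /\
  ln D^-1 <= (1 + e) * (D * zeta_laplace D) + K / e.
Proof.
have [K [K0 hK]] := @laplace_zeta_zpart R.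
(* The 2 bounds the harmonic sum minus ln (1 / D), and 10 * 4 bounds the off-diagonal part since D x
   <= 2; the doublings come from 1 + e <= 2 and 1 + 1 / e <= 2 / e. *)
exists (2 * (2 + 10 * 4) + 2 * K); split; first by lra.
move=> D e /andP[D0 D1] /andP[e0 e1].
have [x [x0 xD Dx]] := exists_cutoff (introT andP (conj D0 D1)).
pose B := laplace D (fun t => nsq (zpart x t)).
pose C := laplace D (fun t => nsq (zeta (critical_line t) - zpart x t)).
have tz := @tame_zeta R.
have tp := @tame_zpart R x.
have tzp := @tame_zeta_zpart R x.
have hC : D * C <= K.
  by have := hK D x (introT andP (conj D0 D1)) x0 xD Dx; rewrite ler_pdivlMr// mulrC.
have xR : (0 : R) < x%:R by rewrite ltr0n.
have hB : `|D * B - ln D^-1| <= 2 + 10 * 4.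
  have /andP[H1 H2] := harmonic_sum_bounds x0.
  have hL1 : ln D^-1 <= ln x%:R.
    by rewrite ler_ln ?posrE ?invr_gt0// -[D^-1]mulr1 ler_pdivrMl.
  have hL2 : ln x%:R <= 1 + ln D^-1.
    have : ln x%:R <= ln (2 * D^-1).
      by rewrite ler_ln ?posrE ?mulr_gt0 ?invr_gt0// ler_pdivlMr// mulrC.
    rewrite lnM ?posrE ?invr_gt0//.
    have : ln 2 <= (1 : R) by have := @le_ln1Dx R 1; rewrite (_ : 1 + 1 = 2)//; apply; lra.
    lra.
  have := laplace_zpart x D0; rewrite -/B => h.
  have hD : `|D * B - harmonic_sum x| <= 10 * 4.
    have -> : D * B - harmonic_sum x = D * (B - harmonic_sum x / D).
      by field; rewrite gt_eqF.
    rewrite normrM gtr0_norm//.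
    apply: (@le_trans _ _ (D * (10 * (D * x%:R ^+ 2)))); first by rewrite ler_pM2l.
    have : 0 <= D * x%:R by rewrite mulr_ge0// ltW.
    nra.
  move: hD; rewrite !ler_norml => /andP[? ?]; apply/andP; split; lra.
have ei : 1 <= e^-1 by rewrite -invr1 lef_pV2 ?posrE.
have hup : zeta_laplace D <= (1 + e) * B + (1 + e^-1) * C.
  rewrite /B /C -!laplaceZ// -laplaceD//; try exact: tameZ.
  apply: le_laplace => //; first by apply: tameD; apply: tameZ.
  by move=> t _; rewrite -{1}(subrK (zpart x t) (zeta _)) addrC nsqD_le.
have hlo : B <= (1 + e) * zeta_laplace D + (1 + e^-1) * C.
  rewrite /B /C /zeta_laplace -!laplaceZ// -laplaceD//; try exact: tameZ.
  apply: le_laplace => //; first by apply: tameD; apply: tameZ.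
  move=> t _.
  have := nsqD_le (zeta (critical_line t)) (- (zeta (critical_line t) - zpart x t)) e0.
  by rewrite nsqN opprB addrC subrK.
have C0 : 0 <= D * C.
  by rewrite mulr_ge0 ?(ltW D0)//; apply: laplace_ge0 => t _; exact: nsq_ge0.
have hc : (1 + e^-1) * (D * C) <= 2 * K / e.
  rewrite mulrAC; apply: ler_pM => //; first by lra.
  by lra.
have hk : (1 + e) * (2 + 10 * 4) <= 2 * (2 + 10 * 4) / e.
  apply: (@le_trans _ _ (2 * (2 + 10 * 4))); first lra.
  by rewrite ler_peMr.
move: hB; rewrite ler_norml => /andP[hB1 hB2].
have hup' : D * zeta_laplace D <= (1 + e) * (D * B) + (1 + e^-1) * (D * C).
  have := ler_wpM2l (ltW D0) hup; lra.
have hlo' : D * B <= (1 + e) * (D * zeta_laplace D) + (1 + e^-1) * (D * C).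
  have := ler_wpM2l (ltW D0) hlo; lra.
have sp : (2 * (2 + 10 * 4) + 2 * K) / e = 2 * (2 + 10 * 4) / e + 2 * K / e by ring.
rewrite sp; split.
  have : (1 + e) * (D * B) <= (1 + e) * (ln D^-1 + (2 + 10 * 4)).
    by rewrite ler_wpM2l//; lra.
  lra.
lra.
Qed.

Lemma zeta_laplace_asymp :
  (fun u => zeta_laplace u^-1 / (u * ln u)) @ +oo --> (1 : R).
Proof.
have [K [K0 hK]] := zeta_laplace_cmp.
apply/cvgrPdist_le => eps eps0.
pose e := Num.min 1 (eps / 2).
have e0 : 0 < e by rewrite lt_min ltr01 divr_gt0.
have e1 : e <= 1 by rewrite ge_min lexx.
have e2 : e <= eps / 2 by rewrite ge_min lexx orbT.
near=> u.
have u1 : 1 < u by near: u; exact: nbhs_pinfty_gt.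
have u0 : 0 < u by rewrite (lt_trans ltr01).
(* Chosen so that K / e <= e ln u; the total relative error is then 2 e <= eps. *)
have lnu : K / e / e <= ln u.
  rewrite -[leLHS]expRK ler_ln ?posrE ?expR_gt0//.
have ln0 : 0 < ln u by rewrite ln_gt0.
have D1 : 0 < u^-1 <= 1 by rewrite invr_gt0 u0 invf_le1// ltW.
have [hu hl] := hK u^-1 e D1 (introT andP (conj e0 e1)).
rewrite invrK in hu hl.
have hKe : K / e <= e * ln u by rewrite -ler_pdivrMl// mulrC.
set z := u^-1 * zeta_laplace u^-1 in hu hl.
have -> : zeta_laplace u^-1 / (u * ln u) = z / ln u by rewrite /z invfM mulrA (mulrC _ u^-1).
rewrite -(ler_pM2r ln0).
have -> : `|1 - z / ln u| * ln u = `|ln u - z|.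
  rewrite -[X in _ * X](gtr0_norm ln0) -normrM; congr `|_|.
  by field; rewrite gt_eqF.
have h2 : 2 * e * ln u <= eps * ln u by rewrite ler_pM2r//; lra.
apply: le_trans h2; rewrite ler_norml; apply/andP; split; first by lra.
nra.
Unshelve. all: by end_near. Qed.

End DirichletMeanSquare.

(** * Jacob's ladders *)

Section MomentIncrements.
Context {R : realType}.
Implicit Types (D h t u y b c : R).

Let zf t : R := nsq (zeta (critical_line t)).

Let intB (A : set (measurableTypeR R)) (f g : R -> R) : measurable A ->
  lebesgue_measure.-integrable A (EFin \o f) -> lebesgue_measure.-integrable A (EFin \o g) ->
  lebesgue_measure.-integrable A (EFin \o (fun t => f t - g t)).
Proof. by move=> mA hf hg; exact: (integrableB mA hf hg). Qed.

Let intZ (A : set (measurableTypeR R)) (k : R) (f : R -> R) : measurable A ->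
  lebesgue_measure.-integrable A (EFin \o f) ->
  lebesgue_measure.-integrable A (EFin \o (fun t => k * f t)).
Proof. by move=> mA hf; exact: (integrableZl mA k hf). Qed.

(** Convexity of the transform as an inequality between secant slopes. Under the integral both
    increments are compared with t exp (- D t) through exp y >= 1 + y, so the transform is never
    differentiated. *)
Lemma zeta_laplace_slope_ge D D' h : 0 < D' -> 0 < h -> D' < D ->
  (D - D') / h * (zeta_laplace D - zeta_laplace (D + h)) <= zeta_laplace D' - zeta_laplace D.
Proof.
move=> D'0 h0 DD; have D0 : 0 < D := lt_trans D'0 DD.
have Dh0 : 0 < D + h by rewrite addr_gt0.
have tz := @tame_zeta R.
rewrite -!RintegralB//; try exact: tame_integrable.
rewrite -RintegralZl//; last first.
  by apply: intB => //; exact: tame_integrable.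
apply: le_Rintegral => //.
- by apply: intZ => //; apply: intB => //; exact: tame_integrable.
- by apply: intB => //; exact: tame_integrable.
move=> t; rewrite /= in_itv/= andbT => t0.
rewrite -!mulrBr mulrCA ler_wpM2l ?nsq_ge0//.
have -> : expR (- ((D + h) * t)) = expR (- (D * t)) * expR (- (h * t)).
  by rewrite -expRD; congr expR; ring.
have -> : expR (- (D' * t)) = expR (- (D * t)) * expR ((D - D') * t).
  by rewrite -expRD; congr expR; ring.
have := @expR_ge1Dx R ((D - D') * t); have := @expR_ge1Dx R (- (h * t)).
have := expR_gt0 (- (D * t)); set E := expR (- (D * t)).
set a := expR (- (h * t)); set b := expR _ => E0 ha hb.
have -> : (D - D') / h * (E - E * a) = E * ((D - D') / h * (1 - a)) by ring.
have -> : E * b - E = E * (b - 1) by ring.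
rewrite ler_pM2l//.
apply: (@le_trans _ _ ((D - D') / h * (h * t))).
  rewrite ler_wpM2l ?divr_ge0 ?subr_ge0 ?(ltW DD) ?(ltW h0)//; lra.
have -> : (D - D') / h * (h * t) = (D - D') * t by field; rewrite gt_eqF.
lra.
Qed.

Lemma zeta_laplace_slope_le D D' h : 0 < h -> h < D' -> D' < D ->
  zeta_laplace D' - zeta_laplace D <= (D - D') / h * (zeta_laplace (D' - h) - zeta_laplace D').
Proof.
move=> h0 hD DD; have D'0 : 0 < D' := lt_trans h0 hD.
have D0 : 0 < D := lt_trans D'0 DD.
have Dh0 : 0 < D' - h by rewrite subr_gt0.
have tz := @tame_zeta R.
rewrite -!RintegralB//; try exact: tame_integrable.
rewrite -RintegralZl//; last first.
  by apply: intB => //; exact: tame_integrable.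
apply: le_Rintegral => //.
- by apply: intB => //; exact: tame_integrable.
- by apply: intZ => //; apply: intB => //; exact: tame_integrable.
move=> t; rewrite /= in_itv/= andbT => t0.
rewrite -!mulrBr mulrCA ler_wpM2l ?nsq_ge0//.
have -> : expR (- ((D' - h) * t)) = expR (- (D' * t)) * expR (h * t).
  by rewrite -expRD; congr expR; ring.
have -> : expR (- (D * t)) = expR (- (D' * t)) * expR (- ((D - D') * t)).
  by rewrite -expRD; congr expR; ring.
have := @expR_ge1Dx R (- ((D - D') * t)); have := @expR_ge1Dx R (h * t).
have := expR_gt0 (- (D' * t)); set E := expR (- (D' * t)).
set a := expR (h * t); set b := expR _ => E0 ha hb.
have -> : (D - D') / h * (E * a - E) = E * ((D - D') / h * (a - 1)) by ring.
have -> : E - E * b = E * (1 - b) by ring.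
rewrite ler_pM2l//.
apply: (@le_trans _ _ ((D - D') / h * (h * t))); last first.
  rewrite ler_wpM2l ?divr_ge0 ?subr_ge0 ?(ltW DD) ?(ltW h0)//; lra.
have -> : (D - D') / h * (h * t) = (D - D') * t by field; rewrite gt_eqF.
lra.
Qed.

(** Beyond X half of the exponent yields the small factor and the other half keeps the integral
    convergent. *)
Lemma laplace_tail D X : 0 < D -> 0 <= X ->
  exists tail : R, \int[lebesgue_measure]_(t in `[0, X]) (zf t * expR (- (D * t)))
    = zeta_laplace D - tail /\
    0 <= tail <= expR (- (D / 2 * X)) * zeta_laplace (D / 2).
Proof.
move=> D0 X0; have D20 : 0 < D / 2 by rewrite divr_gt0.
have tz := @tame_zeta R.
have iD := tame_integrable D0 tz; have iD2 := tame_integrable D20 tz.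
exists (\int[lebesgue_measure]_(t in `]X, +oo[) (zf t * expR (- (D * t)))); split.
  rewrite /zeta_laplace /laplace.
  rewrite -(@Rintegral_itvB _ _ (BLeft 0) +oo%O X)//; first by rewrite opprB addrC subrK.
apply/andP; split.
  by apply: Rintegral_ge0 => t _; rewrite mulr_ge0 ?expR_ge0 ?nsq_ge0.
have sub : ([set` `]X, +oo[] : set R) `<=` [set` `[0, +oo[].
  by move=> t /=; rewrite !in_itv/= !andbT => /ltW; exact: le_trans.
have mX := @measurable_itvR R `]X, +oo[.
have m0 := @measurable_itvR R `[0, +oo[.
rewrite /zeta_laplace /laplace -RintegralZl//.
have e (t : R) : expR (- (D * t)) = expR (- (D / 2 * t)) * expR (- (D / 2 * t)).
  by rewrite -expRD; congr expR; field.
apply: (@le_trans _ _ (\int[lebesgue_measure]_(t in `]X, +oo[)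
    (expR (- (D / 2 * X)) * (zf t * expR (- (D / 2 * t)))))).
  apply: le_Rintegral => //.
  - exact: integrableS iD.
  - by apply: integrableS (integrableZl m0 _ iD2).
  move=> t; rewrite /= in_itv/= andbT => Xt.
  rewrite e mulrCA ler_wpM2r ?mulr_ge0 ?expR_ge0 ?nsq_ge0//.
  by rewrite ler_expR lerN2 ler_pM2l// ltW.
(* Enlarging the domain from ]X, +oo[ to [0, +oo[ is monotone for nonnegative integrands in the
   extended reals. *)
rewrite /Rintegral fine_le//.
- apply: integrable_fin_num => //; exact: integrableS (integrableZl m0 _ iD2).
- apply: integrable_fin_num => //; exact: (integrableZl m0 _ iD2).
apply: ge0_subset_integral => //.
- have := measurable_int _ (integrableZl m0 (expR (- (D / 2 * X))) iD2).
  by apply.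
- by move=> t _; rewrite lee_fin !mulr_ge0 ?expR_ge0 ?nsq_ge0.
Qed.

(** With v = c (u + b), v / u tends to c and ln v / ln u tends to 1. Values at several scales thus
    share the normalisation u ln u and can be subtracted. *)
Lemma zeta_laplace_ratio c b : 0 < c ->
  (fun u => zeta_laplace (c * (u + b))^-1 / (u * ln u)) @ +oo --> c.
Proof.
move=> c0.
pose v u := c * (u + b).
have vy : v u @[u --> +oo] --> +oo.
  apply: gt0_cvgMry => //; apply/cvgryPge => A; near=> u.
  by rewrite -lerBlDr; near: u; exact: nbhs_pinfty_ge.
have h1 : (fun u => zeta_laplace (v u)^-1 / (v u * ln (v u))) @ +oo --> (1 : R).
  apply: (@cvg_comp _ _ _ v (fun u => zeta_laplace u^-1 / (u * ln u)) _ _ _ vy).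
  exact: zeta_laplace_asymp.
have iu : (fun u : R => u^-1) @ +oo --> (0 : R).
  by apply/gtr0_cvgV0; [exact: nbhs_pinfty_gt|exact: cvg_id].
have h2 : (fun u => c * (1 + b * u^-1)) @ +oo --> c.
  rewrite -[X in _ --> X]mulr1 -[X in _ --> c * X]addr0 -[X in _ --> c * (1 + X)](mulr0 b).
  apply: cvgMr; apply: cvgD; first exact: cvg_cst.
  exact: cvgMr.
have lny : ln u @[u --> +oo] --> (+oo : set_system R).
  apply/cvgryPge => A; near=> u.
  have u0 : 0 < u by near: u; exact: nbhs_pinfty_gt.
  by rewrite -[A]expRK ler_ln ?posrE ?expR_gt0.
have il : (fun u : R => (ln u)^-1) @ +oo --> (0 : R).
  by apply: (@cvg_comp _ _ _ (@ln R) (fun u => u^-1) _ _ _ lny).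
have h3 : (fun u => ln (c * (1 + b * u^-1))) @ +oo --> ln c.
  by apply: (@cvg_comp _ _ _ _ (@ln R) _ _ _ h2); exact: continuous_ln.
have h4 : (fun u => 1 + ln (c * (1 + b * u^-1)) * (ln u)^-1) @ +oo --> (1 : R).
  rewrite -[X in _ --> X]addr0 -[X in _ --> (1 : R) + X](mulr0 (ln c)).
  by apply: cvgD; [exact: cvg_cst|exact: cvgM].
have h5 : (fun u => zeta_laplace (v u)^-1 / (v u * ln (v u)) * (c * (1 + b * u^-1))
     * (1 + ln (c * (1 + b * u^-1)) * (ln u)^-1)) @ +oo --> c.
  rewrite -[X in _ --> X]mul1r -[X in _ --> X]mulr1.
  by apply: cvgM => //; exact: cvgM.
move: h5; apply: cvg_trans; apply: near_eq_cvg; near=> u.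
have u1 : 1 < u by near: u; exact: nbhs_pinfty_gt.
have u0 : 0 < u by rewrite (lt_trans ltr01).
have ub : 1 < v u by near: u; exact: cvgry_gt.
have lu0 : 0 < ln u by rewrite ln_gt0.
have lv0 : 0 < ln (v u) by rewrite ln_gt0.
have vE : c * (1 + b * u^-1) = v u / u by rewrite /v; field; rewrite gt_eqF.
have v0 : 0 < v u by rewrite (lt_trans ltr01).
rewrite /= vE ln_div ?posrE//.
by field; rewrite !gt_eqF.
Unshelve. all: by end_near. Qed.

End MomentIncrements.

(** * Moments of zeta over ladder intervals *)

Section Ladder.
Context {R : realType}.
Implicit Types (a b t u y T : R).

Lemma zeta_sqE t : zeta_sq t = nsq (zeta (critical_line t)).
Proof. by rewrite /zeta_sq normc_sqr. Qed.

Lemma hardyZ2E t : hardyZ2 t = nsq (zeta (critical_line t)).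
Proof. by rewrite /hardyZ2 normc_sqr /hardyZ nsqM {1}/nsq /= cos2Dsin2 mul1r. Qed.

(** On [0, b] the weight exp (b - t) is at least 1, so integrability of the transform at D = 1
    dominates. *)
Lemma integrable_zeta_sq b : 0 <= b ->
  lebesgue_measure.-integrable `[0, b] (EFin \o (@zeta_sq R)).
Proof.
move=> b0.
have i1 := tame_integrable ltr01 (@tame_zeta R).
have m0 := @measurable_itvR R `[0, +oo[.
have mb := @measurable_itvR R `[0, b].
have i2 := integrableZl m0 (expR b) i1.
have sub : ([set` `[0, b]] : set R) `<=` [set` `[0, +oo[].
  by move=> t /=; rewrite !in_itv/= andbT => /andP[].
apply: le_integrable (integrableS m0 mb sub i2) => //.
- apply/measurable_EFinP; rewrite (_ : zeta_sq = (fun t => nsq (zeta (critical_line t)))).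
    by apply: measurable_funTS; apply: measurable_nsq; exact: cmeasurable_zeta.
  by apply/funext => t; exact: zeta_sqE.
- move=> t /=; rewrite in_itv/= => /andP[t0 tb]; rewrite lee_fin zeta_sqE.
  rewrite !ger0_norm ?mulr_ge0 ?expR_ge0 ?nsq_ge0//.
  by rewrite mulrCA ler_peMr ?nsq_ge0// mul1r -expRD -[leLHS]expR0 ler_expR subr_ge0.
Qed.

Lemma oint_zeta_sq a b : 0 <= a -> a <= b ->
  oint a b zeta_sq = oint 0 b (@hardyZ2 R) - oint 0 a hardyZ2.
Proof.
move=> a0 ab; have b0 := le_trans a0 ab.
have E : (@hardyZ2 R) = zeta_sq by apply/funext => t; rewrite hardyZ2E zeta_sqE.
rewrite /oint a0 b0 ab E.
have ib := integrable_zeta_sq b0.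
rewrite (@Rintegral_itvB _ _ (BLeft 0) (BRight b) a)//.
rewrite Rintegral_itv_obnd_cbnd//.
apply: integrableS ib => //.
by move=> t /=; rewrite !in_itv/= => /andP[/ltW at0 ->]; rewrite (le_trans a0 at0).
Qed.

(** For such X the exponential is at most u^-3, while the transform at 1 / u is at most 2 u ln u <=
    2 u^2; the product is at most 2 / u. *)
Lemma laplace_tail_small : \forall u \near +oo, forall X, 7 * u * ln u <= X ->
  expR (- (u^-1 * X)) * zeta_laplace u^-1 <= (1 : R).
Proof.
have := @zeta_laplace_asymp R => /cvgrPdist_le /(_ 1 ltr01) asy.
near=> u => X hX.
have u2 : 2 <= u by near: u; exact: nbhs_pinfty_ge.
have u0 : 0 < u by rewrite (lt_le_trans _ u2).
have lu0 : 0 < ln u by rewrite ln_gt0// (lt_le_trans _ u2)// ltr1n.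
have lu : ln u <= u.
  by have := @expR_ge1Dx R (ln u); rewrite lnK ?posrE//; lra.
have q : zeta_laplace u^-1 <= 2 * (u * u).
  have : `|1 - zeta_laplace u^-1 / (u * ln u)| <= 1 by near: u.
  rewrite ler_norml => /andP[h _].
  have : zeta_laplace u^-1 / (u * ln u) <= 2 by lra.
  rewrite ler_pdivrMr ?mulr_gt0// => /le_trans; apply.
  by rewrite ler_pM2l// ler_pM2l.
have e : expR (- (u^-1 * X)) <= u^-1 * u^-1 * u^-1.
  have -> : u^-1 * u^-1 * u^-1 = expR (- (3 * ln u)).
    rewrite expRN (_ : 3 * ln u = ln u + ln u + ln u); last by ring.
    by rewrite !expRD lnK ?posrE// !invfM.
  rewrite ler_expR lerN2 ler_pdivlMl//; apply: le_trans hX.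
  have := mulr_gt0 u0 lu0; lra.
apply: (@le_trans _ _ (u^-1 * u^-1 * u^-1 * (2 * (u * u)))).
  apply: ler_pM => //.
  by apply: laplace_ge0 => t _; exact: nsq_ge0.
have -> : u^-1 * u^-1 * u^-1 * (2 * (u * u)) = 2 / u by field; rewrite gt_eqF.
by rewrite ler_pdivrMr// mul1r.
Unshelve. all: by end_near. Qed.

Lemma ladder_inv_spec (mu phi : R -> R) T0 : jacobs_ladder mu phi T0 ->
  \forall T \near +oo, [/\ T0 <= ladder_inv phi T0 T, 0 <= ladder_inv phi T0 T &
    phi (ladder_inv phi T0 T) = 2 * T].
Proof.
move=> [_ _ inc im].
(* Once T is at least the value of [phi1] at m, monotonicity forces the preimage of T to be at least
   m, hence nonnegative. *)
pose m := Num.max T0 0.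
near=> T.
have mT0 : T0 <= m by rewrite le_max lexx.
have m0 : 0 <= m by rewrite le_max lexx orbT.
have hT : phi1 phi m <= T by near: T; apply: nbhs_pinfty_ge; exact: num_real.
have incW x y : T0 <= x -> x <= y -> phi1 phi x <= phi1 phi y.
  move=> x0; rewrite le_eqVlt => /predU1P[->//|xy]; apply/ltW/inc => //.
    by rewrite in_itv/= x0.
  by rewrite in_itv/= (le_trans x0 (ltW xy)).
have TI : (phi1 phi @` `[T0, +oo[) T.
  by rewrite im /= in_itv/= andbT (le_trans _ hT)// incW.
have hA : `[T0, +oo[%classic (ladder_inv phi T0 T).
  apply: (@surjpinv_image_sub _ _ (fun=> T0) _ (phi1 phi @` `[T0, +oo[) (phi1 phi)).
    exact: subset_refl.
  by exists T.
have hT0 : T0 <= ladder_inv phi T0 T by move: hA; rewrite /= in_itv/= andbT.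
have hE : phi1 phi (ladder_inv phi T0 T) = T.
  by rewrite /ladder_inv pinvK// inE.
split=> //; last by rewrite -[in RHS]hE /phi1; field.
apply: (le_trans m0); rewrite leNgt; apply/negP => lt.
have := incW _ _ hT0 (ltW lt).
have : phi1 phi (ladder_inv phi T0 T) < phi1 phi m.
  by apply: inc => //; rewrite in_itv/= andbT.
by rewrite hE ltNge hT.
Unshelve. all: by end_near. Qed.

Lemma nbhs_pinfty_shift (P : R -> Prop) b :
  (\forall T \near +oo, P T) -> \forall T \near +oo, P (T + b).
Proof.
move=> [M [Mr h]]; exists (M - b); split; first exact: num_real.
by move=> x hx; apply: h; rewrite -ltrBlDr.
Qed.

Lemma nbhs_pinfty_scale (P : R -> Prop) b : 0 < b ->
  (\forall T \near +oo, P T) -> \forall T \near +oo, P (b * T).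
Proof.
move=> b0 [M [Mr h]]; exists (b^-1 * M); split; first exact: num_real.
by move=> x hx; apply: h; rewrite -ltr_pdivrMl.
Qed.

(** At [T]^1 the ladder has phi = 2 T, so the exponent 2 / phi is 1 / T and the defining identity is
    the transform at 1 / T cut off at mu (2 T). Admissibility of mu is evaluated at y = 2 T, where
    the cut-off tail is at most 1. *)
Lemma ladder_oint (mu phi : R -> R) T0 : jacobs_ladder mu phi T0 ->
  \forall T \near +oo,
    zeta_laplace T^-1 - 1 <= oint 0 (ladder_inv phi T0 T) hardyZ2 <= zeta_laplace T^-1.
Proof.
move=> lad; have [adm eqn _ _] := lad.
have adm2 := nbhs_pinfty_scale (ltr0n R 2 : 0 < 2) adm.
have small2 := nbhs_pinfty_scale (ltr0n R 2 : 0 < 2) laplace_tail_small.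
near=> T.
have [hT0 h0 hphi] : [/\ T0 <= ladder_inv phi T0 T, 0 <= ladder_inv phi T0 T &
    phi (ladder_inv phi T0 T) = 2 * T] by near: T; exact: ladder_inv_spec lad.
have T1 : 1 < T by near: T; exact: nbhs_pinfty_gt.
have T00 : 0 < T by rewrite (lt_trans ltr01).
have hmu : 7 * (2 * T) * ln (2 * T) <= mu (2 * T) by near: T.
have hs : forall X, 7 * (2 * T) * ln (2 * T) <= X ->
  expR (- ((2 * T)^-1 * X)) * zeta_laplace (2 * T)^-1 <= 1 by near: T.
have mu0 : 0 <= mu (2 * T).
  apply: le_trans hmu; rewrite !mulr_ge0 ?(ltW T00)// ln_ge0//; lra.
have eT : 2 / (2 * T) = T^-1 by field; rewrite gt_eqF.
rewrite -eqn// hphi /oint mu0.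
have -> : (fun t => hardyZ2 t * expR (- (2 / (2 * T) * t))) =
  (fun t => nsq (zeta (critical_line t)) * expR (- (T^-1 * t))).
  by apply/funext => t; rewrite hardyZ2E eT.
have Ti0 : 0 < T^-1 by rewrite invr_gt0.
have [tail [-> /andP[t0 t1]]] := laplace_tail Ti0 mu0.
have : tail <= 1.
  apply: le_trans t1 _.
  have -> : T^-1 / 2 = (2 * T)^-1 by rewrite invfM mulrC.
  exact: hs.
by move=> tail1; rewrite lerD2l lerN2 tail1 gerBl t0.
Unshelve. all: by end_near. Qed.

Lemma inv_ln_cvg0 : (fun T : R => (ln T)^-1) @ +oo --> (0 : R).
Proof.
have lny : ln u @[u --> +oo] --> (+oo : set_system R).
  apply/cvgryPge => A; near=> u.
  have u0 : 0 < u by near: u; exact: nbhs_pinfty_gt.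
  by rewrite -[A]expRK ler_ln ?posrE ?expR_gt0.
apply: (@cvg_comp _ _ _ (@ln R) (fun u => u^-1) _ _ _ lny).
by apply/gtr0_cvgV0; [exact: nbhs_pinfty_gt|exact: cvg_id].
Unshelve. all: by end_near. Qed.

(** The upper bound for the moment divided by ln T; its limit equals b / (1 - e), and 1 / ln T
    carries the truncation error. The factor 1 in [1 * (T + b)] gives the shape of
    [zeta_laplace_ratio]. *)
Lemma moment_upper_cvg b (e : R) : e < 1 ->
  (fun T => b / e * (zeta_laplace ((1 - e)^-1 * (T + b))^-1 / (T * ln T)
             - zeta_laplace (1 * (T + b))^-1 / (T * ln T))
            + (ln T)^-1) @ +oo --> b / e * ((1 - e)^-1 - 1).
Proof.
move=> e1; rewrite -[X in _ --> X]addr0.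
apply: cvgD; last exact: inv_ln_cvg0.
apply: cvgMr; apply: cvgB.
  by apply: zeta_laplace_ratio; rewrite invr_gt0 subr_gt0.
exact: zeta_laplace_ratio.
Qed.

Lemma moment_lower_cvg b (e : R) : 0 < e ->
  (fun T => b / e * ((zeta_laplace (1 * (T + 0))^-1 / (T * ln T)
             - zeta_laplace ((1 + e)^-1 * (T + 0))^-1 / (T * ln T)) * (1 + b / T)^-1)
            - (ln T)^-1) @ +oo --> b / e * (1 - (1 + e)^-1).
Proof.
move=> e0; rewrite -[X in _ --> X]subr0.
apply: cvgB; last exact: inv_ln_cvg0.
apply: cvgMr; rewrite -[X in _ --> X]mulr1; apply: cvgM.
  apply: cvgB; first exact: zeta_laplace_ratio.
  by apply: zeta_laplace_ratio; rewrite invr_gt0 addr_gt0.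
rewrite -[X in _ --> X]invr1; apply: cvgV; first exact: oner_neq0.
rewrite -[X in _ --> X]addr0 -[X in _ --> (1 : R) + X](mulr0 b).
apply: cvgD; first exact: cvg_cst.
apply: cvgMr; apply/gtr0_cvgV0; [exact: nbhs_pinfty_gt|exact: cvg_id].
Qed.

(** The algebra of the squeeze, with the analysis abstracted away: L is ln T, w the moment, and z,
    zb, zu, zl are the transforms at 1 / T, 1 / (T + b), (1 - e) / (T + b) and (1 + e) / T. The
    limits b / (1 - e) and b / (1 + e) lie within 2 b e <= eps / 2 of b. *)
Lemma moment_sandwich b e T L z zb zu zl w eps : 0 < b -> 0 < e <= 2^-1 ->
  b * e <= eps / 4 -> 0 < T -> 0 < L ->
  `|b / e * ((1 - e)^-1 - 1) - (b / e * (zu / (T * L) - zb / (T * L)) + L^-1)| <= eps / 2 ->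
  `|b / e * (1 - (1 + e)^-1) - (b / e * ((z / (T * L) - zl / (T * L)) * (1 + b / T)^-1) - L^-1)|
    <= eps / 2 ->
  zb - z <= b / (T * e) * (zu - zb) ->
  b / ((T + b) * e) * (z - zl) <= zb - z ->
  zb - z - 1 <= w <= zb - z + 1 ->
  `|b - w / L| <= eps.
Proof.
move=> b0 /andP[e0 e12] be T0 L0 hup hdn up1 dn1 /andP[w1 w2].
have e1 : 0 < 1 - e by lra.
have Wup : w / L <= b / e * ((1 - e)^-1 - 1) + eps / 2.
  have h : w <= b / (T * e) * (zu - zb) + 1 by lra.
  apply: (@le_trans _ _ ((b / (T * e) * (zu - zb) + 1) / L)).
    by rewrite ler_pM2r ?invr_gt0.
  have -> : (b / (T * e) * (zu - zb) + 1) / L = b / e * (zu / (T * L) - zb / (T * L)) + L^-1.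
    by field; rewrite !gt_eqF.
  by move: hup; rewrite ler_norml => /andP[]; lra.
have Wdn : b / e * (1 - (1 + e)^-1) - eps / 2 <= w / L.
  have h : b / ((T + b) * e) * (z - zl) - 1 <= w by lra.
  apply: (@le_trans _ _ ((b / ((T + b) * e) * (z - zl) - 1) / L)); last first.
    by rewrite ler_pM2r ?invr_gt0.
  have -> : (b / ((T + b) * e) * (z - zl) - 1) / L
   = b / e * ((z / (T * L) - zl / (T * L)) * (1 + b / T)^-1) - L^-1.
    rewrite (_ : 1 + b / T = (T + b) / T); last by field; rewrite gt_eqF.
    by field; rewrite !gt_eqF// addr_gt0.
  by move: hdn; rewrite ler_norml => /andP[]; lra.
rewrite (_ : b / e * ((1 - e)^-1 - 1) = b / (1 - e)) in Wup; last first.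
  by field; rewrite !gt_eqF.
rewrite (_ : b / e * (1 - (1 + e)^-1) = b / (1 + e)) in Wdn; last first.
  by field; rewrite !gt_eqF// addr_gt0.
have u1 : b / (1 - e) <= b + 2 * (b * e).
  rewrite ler_pdivrMr//.
  have : 0 <= b * e * (1 - 2 * e) by rewrite !mulr_ge0 ?(ltW b0) ?(ltW e0)//; lra.
  lra.
have u2 : b - b * e <= b / (1 + e).
  rewrite ler_pdivlMr ?addr_gt0//.
  have : 0 <= b * e * e by rewrite !mulr_ge0 ?(ltW b0) ?(ltW e0).
  lra.
rewrite ler_norml; apply/andP; split; lra.
Qed.

(** The comparison step is e / (T + b), a fixed proportion of D' = 1 / (T + b): over such a step the
    change of the transform is of the order of its main term. *)
Lemma zeta_laplace_inv_le T b e : 0 < T -> 0 < b -> 0 < e < 1 ->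
  zeta_laplace (T + b)^-1 - zeta_laplace T^-1 <=
    b / (T * e) * (zeta_laplace ((1 - e)^-1 * (T + b))^-1 - zeta_laplace (T + b)^-1).
Proof.
move=> T0 b0 /andP[e0 e1]; have Tb0 : 0 < T + b by rewrite addr_gt0.
have DD : (T + b)^-1 < T^-1 by rewrite ltf_pV2 ?posrE// ltrDl.
have h0 : 0 < e / (T + b) by rewrite divr_gt0.
have h1 : e / (T + b) < (T + b)^-1 by rewrite gtr_pMl ?invr_gt0.
have := zeta_laplace_slope_le h0 h1 DD.
rewrite (_ : (T + b)^-1 - e / (T + b) = ((1 - e)^-1 * (T + b))^-1); last first.
  by rewrite invfM invrK; ring.
rewrite (_ : (T^-1 - (T + b)^-1) / (e / (T + b)) = b / (T * e))//.
by field; rewrite !gt_eqF.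
Qed.

Lemma zeta_laplace_inv_ge T b e : 0 < T -> 0 < b -> 0 < e ->
  b / ((T + b) * e) * (zeta_laplace T^-1 - zeta_laplace ((1 + e)^-1 * T)^-1) <=
    zeta_laplace (T + b)^-1 - zeta_laplace T^-1.
Proof.
move=> T0 b0 e0; have Tb0 : 0 < T + b by rewrite addr_gt0.
have DD : (T + b)^-1 < T^-1 by rewrite ltf_pV2 ?posrE// ltrDl.
have Di0 : 0 < (T + b)^-1 by rewrite invr_gt0.
have h0 : 0 < e / T by rewrite divr_gt0.
have := zeta_laplace_slope_ge Di0 h0 DD.
rewrite (_ : T^-1 + e / T = ((1 + e)^-1 * T)^-1); last by rewrite invfM invrK; ring.
rewrite (_ : (T^-1 - (T + b)^-1) / (e / T) = b / ((T + b) * e))//.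
by field; rewrite !gt_eqF.
Qed.

Lemma ladder_moment_bounds (mu phi : R -> R) T0 b : jacobs_ladder mu phi T0 -> 0 < b ->
  \forall T \near +oo,
    zeta_laplace (T + b)^-1 - zeta_laplace T^-1 - 1 <=
    oint (ladder_inv phi T0 T) (ladder_inv phi T0 (T + b)) zeta_sq <=
    zeta_laplace (T + b)^-1 - zeta_laplace T^-1 + 1.
Proof.
move=> lad b0; have [_ _ inc _] := lad.
have spec := ladder_inv_spec lad.
have specb := nbhs_pinfty_shift b spec.
have lo := ladder_oint lad.
have lob := nbhs_pinfty_shift b lo.
apply: filterS2 (filterI spec specb) (filterI lo lob) => T [[t0 t1 t2] [s0 s1 s2]] [].
(* Ordered endpoints select the unreversed branch of [oint], so the moment is a difference of two
   integrals from 0. *)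
have le12 : ladder_inv phi T0 T <= ladder_inv phi T0 (T + b).
  rewrite leNgt; apply/negP => lt.
  have := inc _ _ _ _ lt; rewrite /phi1 t2 s2 !in_itv/= !andbT => /(_ s0 t0).
  by rewrite ltr_pM2r ?invr_gt0// ltr_pM2l// gtrDl ltNge (ltW b0).
rewrite (oint_zeta_sq t1 le12).
move: (zeta_laplace _) (zeta_laplace _) (oint 0 _ _) (oint 0 _ _) => z1 z2 w1 w2.
by move=> /andP[? ?] /andP[? ?]; apply/andP; split; lra.
Qed.

(** The leading order of the known moment formula, with b = 2 l. The parameter e is fixed from eps
    and b before T goes to infinity, so no uniformity in e is called for. *)
Lemma ladder_moment (mu phi : R -> R) T0 b : jacobs_ladder mu phi T0 -> 0 < b ->
  (fun T => oint (ladder_inv phi T0 T) (ladder_inv phi T0 (T + b)) zeta_sq / ln T)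
    @ +oo --> b.
Proof.
move=> lad b0.
apply/cvgrPdist_le => eps eps0.
pose e := Num.min 2^-1 (eps / (4 * b)).
have e0 : 0 < e by rewrite lt_min invr_gt0 ltr0n divr_gt0// mulr_gt0.
have e12 : e <= 2^-1 by rewrite ge_min lexx.
have e1 : e < 1 by apply: le_lt_trans e12 _; lra.
have be : b * e <= eps / 4.
  apply: (@le_trans _ _ (b * (eps / (4 * b)))).
    by rewrite ler_pM2l// ge_min lexx orbT.
  by rewrite le_eqVlt; apply/orP; left; apply/eqP; field; rewrite gt_eqF.
have eps2 : 0 < eps / 2 by rewrite divr_gt0.
have /cvgrPdist_le /(_ _ eps2) up := @moment_upper_cvg b e e1.
have /cvgrPdist_le /(_ _ eps2) dn := @moment_lower_cvg b e e0.
have bd := ladder_moment_bounds lad b0.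
apply: filterS2 (filterI up dn) (filterI bd (nbhs_pinfty_gt (num_real (1 : R)))) => T /= [hup hdn] [hbd T1].
rewrite mul1r in hup; rewrite addr0 mul1r in hdn.
have T00 : 0 < T by rewrite (lt_trans ltr01).
have lT : 0 < ln T by rewrite ln_gt0.
apply: (moment_sandwich b0 (introT andP (conj e0 e12)) be T00 lT hup hdn _ _ hbd).
  by apply: zeta_laplace_inv_le => //; rewrite e0.
exact: zeta_laplace_inv_ge.
Qed.

End Ladder.

(** * Negation and finite products, and the asymptotic formula *)

Section OrientedIntegral.
Context {R : realType}.

(** Negation exchanges the positive and negative parts. If either has infinite integral, [fine]
    sends both sides to 0, so the identity holds for every f. *)
Lemma ointN (a b : R) (f : R -> R) : oint a b (fun t => - f t) = - oint a b f.
Proof.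
have E (A : set (measurableTypeR R)) : \int[lebesgue_measure]_(x in A) (- f x)
    = - \int[lebesgue_measure]_(x in A) f x.
  have e1 := integralE lebesgue_measure A (\- (EFin \o f))%E.
  have e2 := integralE lebesgue_measure A (EFin \o f).
  rewrite funeposN funenegN in e1.
  transitivity (fine (integral lebesgue_measure A (\- (EFin \o f))%E)); first by [].
  transitivity (- fine (integral lebesgue_measure A (EFin \o f)%E)); last by [].
  rewrite e1 e2.
  have : (0 <= integral lebesgue_measure A (EFin \o f)^\+)%E by exact: integral_ge0.
  have : (0 <= integral lebesgue_measure A (EFin \o f)^\-)%E by exact: integral_ge0.
  case: (integral _ _ _) => [p| |]//; case: (integral _ _ _) => [q| |]//= _ _.
  - by rewrite opprB.
  - by rewrite oppr0.
  - by rewrite oppr0.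
  - by rewrite oppr0.
by rewrite /oint; case: ifP => _; rewrite E ?opprK.
Qed.

Lemma cvg_prod_ord k (F : 'I_k -> R -> R) (a : 'I_k -> R) (G : set_system R) :
  Filter G -> (forall r, F r @ G --> a r) ->
  (fun T => \prod_(r < k) F r T) @ G --> \prod_(r < k) a r.
Proof.
move=> FG Fa; elim: (index_enum _) => [|r s IH].
  under eq_fun do rewrite big_nil; rewrite big_nil; exact: cvg_cst.
by under eq_fun do rewrite big_cons; rewrite big_cons; exact: cvgM.
Qed.

End OrientedIntegral.

(** Both sides divided by ln^k T tend to a: the left one because the bounded term is multiplied by
    delta = 1 / ln^k T, the right one because each moment divided by ln T tends to 2 l_r and these
    limits multiply to a. *)
Theorem theorem9 (R : realType)
  (RH : @riemann_hypothesis R)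
  (mu phi : R -> R) (T0 : R) (ladder : jacobs_ladder mu phi T0)
  (a : R) (a_def : a = expR (9 / 2))
  (Delta : R) (Delta_gt0 : 0 < Delta)
  (N : R -> R) (N_gt0 : forall delta, 0 < delta < Delta -> 0 < N delta)
  (N_eq : exists g : R -> R,
     [/\ {within `]0, Delta[, continuous g},
         [bounded g delta | delta in `]0, Delta[] &
         forall delta, 0 < delta < Delta ->
           oint 2 (N delta) prime_error = - (a / delta) + g delta])
  (k : nat) (k_ge2 : (2 <= k)%N)
  (l : 'I_k -> R) (l_gt0 : forall r, 0 < 2 * l r)
  (prod_l : \prod_(r < k) (2 * l r) = a) :
  (fun T : R =>
     oint 2 (N (1 / ln T ^+ k)) (fun t => - prime_error t)
     / \prod_(r < k)
         oint (ladder_inv phi T0 T) (ladder_inv phi T0 (T + 2 * l r)) zeta_sq)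
  @ +oo --> (1 : R).
Proof.
have a0 : 0 < a by rewrite a_def expR_gt0.
have [g [_ gb gE]] := N_eq.
have [M M0 gM] := pinfty_ex_gt0 gb.
have k0 : (0 < k)%N by rewrite (leq_trans _ k_ge2).
(* This is delta; it tends to 0 because k > 0, and so eventually lies in ]0, Delta[. *)
pose q (T : R) := (ln T)^-1 ^+ k.
have q0 : q @ +oo --> (0 : R).
  have -> : 0 = 0 ^+ k :> R by rewrite expr0n gtn_eqF.
  apply: (@cvg_comp _ _ _ (fun T : R => (ln T)^-1) (fun x => x ^+ k) _ _ _ inv_ln_cvg0).
  exact: exprn_continuous.
pose W r (T : R) := oint (ladder_inv phi T0 T) (ladder_inv phi T0 (T + 2 * l r)) zeta_sq.
have WE : (fun T => \prod_(r < k) (W r T / ln T)) @ +oo --> a.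
  rewrite -prod_l; apply: cvg_prod_ord => r.
  exact: ladder_moment ladder (l_gt0 r).
have small : \forall T \near +oo, 1 < T /\ 0 < q T < Delta.
  near=> T.
  have T1 : 1 < T by near: T; exact: nbhs_pinfty_gt.
  split=> //; rewrite exprn_gt0 ?invr_gt0 ?ln_gt0//=.
  near: T.
  exact: (cvgr_lt (0 : R) q0).
pose P (T : R) := oint 2 (N (q T)) (fun t => - prime_error t) * q T.
have PE : P @ +oo --> a.
  apply/cvgrPdist_le => eps eps0.
  (* The difference from a is exactly g (q T) * q T up to sign, hence at most M q T. *)
  have hq : \forall T \near +oo, q T < eps / M.
    by apply: (cvgr_lt (0 : R)) => //; rewrite divr_gt0.
  apply: filterS2 small hq => T [T1 /andP[qT0 qTD]] hq.
  rewrite /P ointN gE ?qT0// opprD opprK mulrBl divfK ?gt_eqF//.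
  rewrite opprB addrC subrK normrM (gtr0_norm qT0).
  have : `|g (q T)| <= M by apply: gM => /=; rewrite in_itv/= qT0.
  move=> gq; apply: (@le_trans _ _ (M * q T)); first by rewrite ler_pM2r.
  by rewrite mulrC -ler_pdivlMr// ltW.
have h : (fun T => P T * (\prod_(r < k) (W r T / ln T))^-1) @ +oo --> (1 : R).
  rewrite -[X in _ --> X](divff (lt0r_neq0 a0)).
  by apply: cvgM => //; apply: cvgV => //; rewrite gt_eqF.
move: h; apply: cvg_trans; apply: near_eq_cvg.
apply: filterS small => T [T1 _].
have lT : ln T != 0 by rewrite gt_eqF// ln_gt0.
have qT0 : q T != 0 by rewrite expf_neq0// invr_eq0.
have -> : \prod_(r < k) (W r T / ln T) = (\prod_(r < k) W r T) * q T.
  by rewrite /q big_split /= prodr_const card_ord.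
by rewrite /P invfM mulrACA divff// mulr1 /q exprVn div1r.
Unshelve. all: by end_near. Qed.
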